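(* Fix integers $n,d\ge 1$, constants $0<h_{min}<h_{max}$, any initial state $\mathcal{X}^{(0)}\in\mathbb{R}^{dn}$, an initial bandwidth $h_1\in[h_{min},h_{max}]$, and a non-negative sequence $(\nu_k)$ with $\nu_k\to 0$. Let $(\mathcal{X}^{(k)})$, $\mathcal{X}^{(k)}=[\mathbf{x}_1^{(k)},\ldots,\mathbf{x}_n^{(k)}]$, be generated by the Doubly Stochastic Mean-Shift (DSMS) process described in the context, and let $\tau$ be a real number with $0<\tau<h_{min}/2$. Then almost surely there exist a partition $J_1,\ldots,J_M$ of $\{1,\ldots,n\}$ and an integer $K$ such that for every $k\ge K$: 1) for all $l\in[M]$, $\max_{i,j\in J_l}\|\mathbf{x}_i^{(k)}-\mathbf{x}_j^{(k)}\|<\tau$; 2) for all $l\ne m$ in $[M]$, $\min_{i\in J_l,\,j\in J_m}\|\mathbf{x}_i^{(k)}-\mathbf{x}_j^{(k)}\|>h_{min}-\tau$. That is, almost surely the points belong to fixed clusters $\mathcal{C}_l=\{\mathbf{x}_i^{(k)}: i\in J_l\}$ for all sufficiently large $k$. Moreover, almost surely the diameters of all clusters tend to $0$ as $k\to\infty$.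
   Context: A profile function is a map $k:[0,\infty)\to\mathbb{R}_+$ that vanishes on $[1,\infty)$, is $C^1$, non-increasing and convex, with $k'(t)<0$ for all $t\in[0,1)$. The associated kernel is $K(\mathbf{u})=k(\|\mathbf{u}\|^2)$ on $\mathbb{R}^d$ and the weight function is $G(\mathbf{u})=-k'(\|\mathbf{u}\|^2)$; $\|\cdot\|$ is the Euclidean norm. A state is $\mathcal{X}=[\mathbf{x}_1,\ldots,\mathbf{x}_n]\in\mathbb{R}^{dn}$, $\mathbf{x}_i\in\mathbb{R}^d$. Mean-shift operator for $h>0$: $\mathcal{S}_h(x;\mathcal{X})=\sum_{i=1}^n G((x-\mathbf{x}_i)/h)\mathbf{x}_i\big/\sum_{i=1}^n G((x-\mathbf{x}_i)/h)$. DSMS process: for $k=0,1,2,\ldots$: if $k\ge1$, set $\delta_k=\min\{\nu_k,\ (h_k/h_{min})^2-1,\ 1-(h_k/h_{max})^2\}$, draw $\alpha_k$ uniformly on $(1-\delta_k,1+\delta_k)$ (with $\alpha_k=1$ if $\delta_k=0$), and set $h_{k+1}=h_k/\sqrt{\alpha_k}$ (so $h_{k+1}\in[h_{min},h_{max}]$); draw $i_k$ uniformly from $\{1,\ldots,n\}$; set $\mathbf{x}_{i_k}^{(k+1)}=\mathcal{S}_{h_{k+1}}(\mathbf{x}_{i_k}^{(k)};\mathcal{X}^{(k)})$ and $\mathbf{x}_j^{(k+1)}=\mathbf{x}_j^{(k)}$ for $j\ne i_k$. The indices $i_k$ are i.i.d., independent of all previous choices, and $(i_k)$, $(h_k)$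 are independent. *)

(* Defs.v *)
From HB Require Import structures.
From mathcomp Require Import all_boot all_order all_algebra.
From mathcomp Require Import all_classical all_reals all_analysis.
Set Implicit Arguments. Unset Strict Implicit. Unset Printing Implicit Defensive.
Import Order.TTheory GRing.Theory Num.Theory.
Import numFieldNormedType.Exports.
Local Open Scope ring_scope.
Local Open Scope classical_set_scope.

Section DSMS.
Variable R : realType.

Definition eucnorm (d : nat) (u : 'rV[R]_d) : R :=
  Num.sqrt (\sum_(j < d) u ord0 j ^+ 2).

Definition eucdist (d : nat) (u v : 'rV[R]_d) : R := eucnorm (u - v).

(* Profile function k : [0,oo) -> R_+ (given as the restriction of a
   function R -> R that is C^1 on R). *)
Definition is_profile (k : R -> R) : Prop :=
  ((forall t, derivable k t 1) /\ continuous ((derive1 k))) /\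
  (forall t, 0 <= t -> 0 <= k t) /\
  (forall t, 1 <= t -> k t = 0) /\
  (forall s t, 0 <= s -> s <= t -> k t <= k s) /\
  (forall s t l, 0 <= s -> 0 <= t -> 0 <= l -> l <= 1 ->
      k (l * s + (1 - l) * t) <= l * k s + (1 - l) * k t) /\
  (forall t, 0 <= t -> t < 1 -> (derive1 k) t < 0).

Definition kernelK (k : R -> R) (d : nat) (u : 'rV[R]_d) : R := k (eucnorm u ^+ 2).
Definition weightG (k : R -> R) (d : nat) (u : 'rV[R]_d) : R := - ((derive1 k) (eucnorm u ^+ 2)).

Definition mean_shift (k : R -> R) (d n : nat) (h : R) (x : 'rV[R]_d)
    (X : 'I_n -> 'rV[R]_d) : 'rV[R]_d :=
  (\sum_(i < n) weightG k (h^-1 *: (x - X i)))^-1 *: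
    \sum_(i < n) (weightG k (h^-1 *: (x - X i)) *: X i).

Definition dsms_delta (hmin hmax nuk hk : R) : R :=
  Num.min nuk (Num.min ((hk / hmin) ^+ 2 - 1) (1 - (hk / hmax) ^+ 2)).

(* Bandwidths: dsms_band ... m = h_{m+1}.  alpha_k = 1 + delta_k * U_k with
   U_k uniform on (-1,1), i.e. alpha_k uniform on (1-delta_k, 1+delta_k). *)
Fixpoint dsms_band (hmin hmax h1 : R) (nu U : nat -> R) (m : nat) : R :=
  match m with
  | 0 => h1
  | m'.+1 =>
      let hk := dsms_band hmin hmax h1 nu U m' in
      let alpha := 1 + dsms_delta hmin hmax (nu m'.+1) hk * U m'.+1 in
      hk / Num.sqrt alpha
  end.

Fixpoint dsms_state (k : R -> R) (d n : nat) (hmin hmax h1 : R)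
    (nu U : nat -> R) (I : nat -> 'I_n) (X0 : 'I_n -> 'rV[R]_d) (m : nat)
    : 'I_n -> 'rV[R]_d :=
  match m with
  | 0 => X0
  | m'.+1 =>
      let X := dsms_state k hmin hmax h1 nu U I X0 m' in
      fun j => if j == I m'
               then mean_shift k (dsms_band hmin hmax h1 nu U m') (X (I m')) X
               else X j
  end.

End DSMS.

Definition open_m1_1 (R : realType) : set R := `]-1, 1[.

(* The driving randomness: i_k (k >= 0) i.i.d. uniform on 'I_n, U_k (k >= 0)
   i.i.d. uniform on (-1,1), all mutually independent (U_0 is unused).
   Stated through all finite-dimensional joint laws. *)
Definition dsms_noise (R : realType) (dT : measure_display) (T : measurableType dT)
    (P : probability T R) (n : nat) (I : nat -> T -> 'I_n) (U : nat -> T -> R) : Prop :=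
  (forall m (a : 'I_n), measurable [set w | I m w = a]) /\
  (forall m, measurable_fun setT (U m)) /\
  (forall (N : nat) (a : nat -> 'I_n) (B : nat -> set R),
      (forall m, measurable (B m)) ->
      P (\bigcap_(m in [set m | (m < N)%N]) [set w | I m w = a m /\ B m (U m w)])
      = (\prod_(m < N) ((n%:R)^-1%:E *
           ((@lebesgue_measure R (B m `&` @open_m1_1 R)) * (2^-1)%:E)))%E).

(* Main.v *)
Require Import Defs.
From HB Require Import structures.
From mathcomp Require Import all_boot all_order all_algebra.
From mathcomp Require Import all_classical all_reals all_analysis.
From mathcomp Require Import measurable_realfun ring lra.
Set Implicit Arguments. Unset Strict Implicit. Unset Printing Implicit Defensive.
Import Order.TTheory GRing.Theory Num.Theory.
Import numFieldNormedType.Exports.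
Local Open Scope ring_scope.
Local Open Scope classical_set_scope.

(** The energy sum_ij k(|x_i - x_j|^2 / h^2) is bounded, and it is a
    submartingale along the process. Convexity of k bounds it below by its
    tangents, so a mean-shift step of x_i raises it by at least a constant times
    |S_h(x_i) - x_i|^2, while a bandwidth step multiplies 1/h^2 by a factor of
    mean 1 and hence does not decrease it on average. As the moving index is
    uniform and independent of the past, the expectations of all the
    |S_h(x_i) - x_i|^2 are summable over time, so almost surely every
    displacement tends to 0. Pairing the displacement of x_i with x_i and summing
    over i then gives G_ij |x_i - x_j|^2 -> 0 for every pair: in the limit two
    points are either together or at distance at least hmin. Since steps tend to
    0, no pair can cross from one alternative to the other infinitely often. *)

(** * Profile and mean shift *)

Section Profile.
Variables (R : realType) (k : R -> R).
Hypothesis hk : is_profile k.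

Definition slope (t : R) : R := - derive1 k t.
Local Notation g := slope.

(** By convexity the difference quotients from [a] towards [b] with step in [(0, 1]] stay below
    [k b - k a], and the directional derivative at [a] is their limit. *)
Lemma profile_tangent (a b : R) : 0 <= a -> 0 <= b -> k a + g a * (a - b) <= k b.
Proof.
case: hk => -[kd _] [_ [_ [_ [kconv _]]]] a0 b0.
have dv : 'D_(b - a) k a = (b - a) * derive1 k a.
  have df : differentiable k a by apply/derivable1_diffP.
  by rewrite deriveE// derive1E deriveE// -[in LHS](mulr1 (b - a)) linearZ.
have cv : derivable k a (b - a) by apply/diff_derivable/derivable1_diffP.
suff : 'D_(b - a) k a <= k b - k a by rewrite dv /slope; lra.
(* Only the right limit is taken, since convexity controls positive steps [l] alone. *)
rewrite /derive cvg_at_rightE//; apply: limr_le.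
  apply: cvgP; apply: cvg_trans; last exact: cv.
  apply: cvg_app => A; rewrite /dnbhs /at_right !nbhs_simpl/= => dA.
  apply: (@filterS _ (nbhs (0 : R)) _ _ _ _ dA) => x h x0.
  exact/h/lt0r_neq0.
near=> l => /=.
have l0 : 0 < l by near: l; exact: nbhs_right_gt.
have l1 : l <= 1 by near: l; apply: nbhs_right_le.
have -> : l *: (b - a) + a = l * b + (1 - l) * a by rewrite /GRing.scale/=; ring.
have := kconv b a l b0 a0 (ltW l0) l1.
rewrite /GRing.scale/= ler_pdivrMl//; lra.
Unshelve. all: by end_near. Qed.

Lemma slope_ge0 t : 0 <= t -> 0 <= g t.
Proof.
move=> t0; case: (hk) => _ [_ [_ [kni _]]].
have t10 : 0 <= t + 1 by lra.
have := profile_tangent t0 t10.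
have := kni t (t + 1) t0 ltac:(lra); lra.
Qed.

(** The sum of the tangent inequalities at [s] and at [t] makes the product of the two differences
    nonpositive. *)
Lemma slope_nincr s t : 0 <= s -> s <= t -> g t <= g s.
Proof.
move=> s0; rewrite le_eqVlt => /orP[/eqP->//|st].
have t0 : 0 <= t by lra.
have h1 := profile_tangent s0 t0; have h2 := profile_tangent t0 s0.
have : (g t - g s) * (t - s) <= 0 by lra.
by rewrite pmulr_lle0 ?subr_gt0// subr_le0.
Qed.

Lemma slope_gt0 t : 0 <= t -> t < 1 -> 0 < g t.
Proof. by case: hk => _ [_ [_ [_ [_ h]]]] t0 t1; rewrite /slope oppr_gt0 h. Qed.

(** The tangent at [t], evaluated at [0], with [k t] nonnegative. It bounds the effect of a
    bandwidth change, however far apart the points are. *)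
Lemma slopeM_le t : 0 <= t -> g t * t <= k 0.
Proof.
move=> t0; case: (hk) => _ [kge0 _].
have := profile_tangent t0 (lexx 0); have := kge0 t t0; lra.
Qed.

Lemma profile_ge0 t : 0 <= t -> 0 <= k t.
Proof. by case: (hk) => _ [h _]; exact: h. Qed.

Lemma profile_le0 t : 0 <= t -> k t <= k 0.
Proof. by case: (hk) => _ [_ [_ [h _]]] t0; exact: h. Qed.

End Profile.

(** * Squared Euclidean norm *)

Section SquaredNorm.
Variables (R : realType) (d : nat).
Implicit Types u v : 'rV[R]_d.

Definition sqn u : R := \sum_(l < d) u ord0 l ^+ 2.

Lemma sqn_ge0 u : 0 <= sqn u.
Proof. by apply: sumr_ge0 => l _; exact: sqr_ge0. Qed.

Lemma sqn0 : sqn 0 = 0.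
Proof. by rewrite /sqn big1// => l _; rewrite mxE expr0n. Qed.

Lemma sqnBC u v : sqn (u - v) = sqn (v - u).
Proof. by apply: eq_bigr => l _; rewrite !mxE -sqrrN opprB. Qed.

Lemma eucnorm_sqr u : eucnorm u ^+ 2 = sqn u.
Proof. by rewrite /eucnorm sqr_sqrtr// sqn_ge0. Qed.

Lemma sqnZ (a : R) u : sqn (a *: u) = a ^+ 2 * sqn u.
Proof. by rewrite /sqn mulr_sumr; apply: eq_bigr => l _; rewrite mxE exprMn. Qed.

Lemma sqnD_le u v : sqn (u + v) <= 2 * sqn u + 2 * sqn v.
Proof.
rewrite /sqn !mulr_sumr -big_split/=; apply: ler_sum => l _; rewrite mxE.
have := sqr_ge0 (u ord0 l - v ord0 l); rewrite !expr2; lra.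
Qed.

Lemma coord_le_eucnorm u l : `|u ord0 l| <= eucnorm u.
Proof.
rewrite /eucnorm -[leLHS]sqrtr_sqr ler_sqrt ?sqn_ge0// (bigD1 l)//= lerDl.
by apply: sumr_ge0 => i _; exact: sqr_ge0.
Qed.

End SquaredNorm.

(** * Energy gain and dissipation of a mean-shift step *)

Section MeanShift.
Variables (R : realType) (k : R -> R) (n d : nat).
Hypothesis hk : is_profile k.
Implicit Types (X : 'I_n -> 'rV[R]_d) (h : R) (i j : 'I_n).
Local Notation g := (slope k).

Definition sdist h X i j : R := h^-1 ^+ 2 * sqn (X i - X j).

Definition energy h X : R := \sum_i \sum_j k (sdist h X i j).

Definition displ h X i : 'rV[R]_d := mean_shift k h (X i) X - X i.

Definition wsum h X i : R := \sum_j g (sdist h X i j).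

Definition update h X i : 'I_n -> 'rV[R]_d :=
  fun j => if j == i then mean_shift k h (X i) X else X j.

Lemma sdist_ge0 h X i j : 0 <= sdist h X i j.
Proof. by rewrite mulr_ge0 ?sqr_ge0 ?sqn_ge0. Qed.

Lemma sdistC h X i j : sdist h X i j = sdist h X j i.
Proof. by rewrite /sdist sqnBC. Qed.

Lemma sdist_refl h X i : sdist h X i i = 0.
Proof. by rewrite /sdist subrr sqn0 mulr0. Qed.

Lemma slope_sdist_ge0 h X i j : 0 <= g (sdist h X i j).
Proof. exact/slope_ge0/sdist_ge0. Qed.

Lemma weightG_sdist h X i j : weightG k (h^-1 *: (X i - X j)) = g (sdist h X i j).
Proof. by rewrite /weightG eucnorm_sqr sqnZ. Qed.

(** A point sees itself at distance 0, so the weight [g 0] is always present and the mean-shift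
    denominator cannot vanish. *)
Lemma wsum_ge h X i : g 0 <= wsum h X i.
Proof.
rewrite /wsum (bigD1 i)//= sdist_refl lerDl.
by apply: sumr_ge0 => j _; exact: slope_sdist_ge0.
Qed.

Lemma wsum_gt0 h X i : 0 < wsum h X i.
Proof. by apply: lt_le_trans (wsum_ge h X i); exact: slope_gt0. Qed.

Lemma wsum_le h X i : wsum h X i <= n%:R * g 0.
Proof.
apply: (@le_trans _ _ (\sum_(j < n) g 0)).
  by apply: ler_sum => j _; apply: slope_nincr => //; exact: sdist_ge0.
by rewrite sumr_const card_ord mulr_natl.
Qed.

Lemma mean_shift_coord h X i l : mean_shift k h (X i) X ord0 l =
  (wsum h X i)^-1 * \sum_j g (sdist h X i j) * X j ord0 l.
Proof.
rewrite /mean_shift mxE summxE; congr (_^-1 * _).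
  by apply: eq_bigr => j _; exact: weightG_sdist.
by apply: eq_bigr => j _; rewrite mxE weightG_sdist.
Qed.

Lemma wsum_mean_shift h X i l : wsum h X i * mean_shift k h (X i) X ord0 l =
  \sum_j g (sdist h X i j) * X j ord0 l.
Proof. by rewrite mean_shift_coord mulVKf// gt_eqF// wsum_gt0. Qed.

Lemma wsum_displ h X i l : wsum h X i * displ h X i ord0 l =
  \sum_j g (sdist h X i j) * (X j ord0 l - X i ord0 l).
Proof.
rewrite mxE [X in _ * (_ + X)]mxE mulrBr wsum_mean_shift /wsum mulr_suml -sumrB.
by apply: eq_bigr => j _; rewrite mulrBr.
Qed.

(** The mean shift is a convex combination of the points, so it stays in every box that contains
    them. *)
Lemma mean_shift_bound h X i l (C : R) : (forall j, `|X j ord0 l| <= C) ->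
  `|mean_shift k h (X i) X ord0 l| <= C.
Proof.
move=> XC; rewrite mean_shift_coord normrM gtr0_norm ?invr_gt0 ?wsum_gt0//.
rewrite ler_pdivrMl ?wsum_gt0// (le_trans (ler_norm_sum _ _ _))// mulr_suml.
apply: ler_sum => j _; rewrite normrM ger0_norm ?slope_sdist_ge0//.
by rewrite ler_wpM2l ?slope_sdist_ge0.
Qed.

(* The mean shift minimises the weighted sum of squared distances to the points,
   which the tangent inequality for [k] turns into an increase of the energy. *)
Lemma mean_shift_decrease h X i :
  \sum_j g (sdist h X i j) *
    (sqn (X i - X j) - sqn (mean_shift k h (X i) X - X j))
  = wsum h X i * sqn (displ h X i).
Proof.
rewrite /displ; have := wsum_mean_shift h X i.
set y := mean_shift _ _ _ _; clearbody y => yE.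
transitivity (\sum_j \sum_l g (sdist h X i j) *
    ((X i ord0 l - X j ord0 l) ^+ 2 - (y ord0 l - X j ord0 l) ^+ 2)).
  apply: eq_bigr => j _; rewrite /sqn -sumrB mulr_sumr.
  by apply: eq_bigr => l _; rewrite !mxE.
rewrite exchange_big/= /sqn mulr_sumr; apply: eq_bigr => l _.
rewrite !mxE.
(* After expansion the points [X j] enter linearly, and by [yE] their weighted sum is the total
   weight times [y]. *)
transitivity (wsum h X i * (X i ord0 l ^+ 2 - y ord0 l ^+ 2)
    - 2 * (X i ord0 l - y ord0 l) * (wsum h X i * y ord0 l)); last ring.
rewrite yE /wsum mulr_suml mulr_sumr -sumrB.
by apply: eq_bigr => j _; ring.
Qed.

(** Tangents turn the gain of energy into weighted decreases [q] of squared distances. Only pairs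
    containing [i] change, and each is counted twice; [wsum_ge] supplies the constant [g 0]. *)
Lemma energy_update h X i : energy h X + h^-1 ^+ 2 * g 0 * sqn (displ h X i)
  <= energy h (update h X i).
Proof.
pose q a b := sqn (X a - X b) - sqn (update h X i a - update h X i b).
have qC a b : q a b = q b a by rewrite /q sqnBC [in X in _ - X]sqnBC.
have q0 a b : a != i -> b != i -> q a b = 0.
  by move=> /negbTE ai /negbTE bi; rewrite /q /update ai bi subrr.
have qii : q i i = 0 by rewrite /q !subrr.
have tang a b : k (sdist h X a b) + h^-1 ^+ 2 * (g (sdist h X a b) * q a b)
    <= k (sdist h (update h X i) a b).
  apply: le_trans (profile_tangent hk (sdist_ge0 h X a b)
    (sdist_ge0 h (update h X i) a b)).
  rewrite mulrCA (_ : _ * q a b = sdist h X a b - sdist h (update h X i) a b)//.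
  by rewrite /sdist /q mulrBr.
apply: (@le_trans _ _ (energy h X +
    h^-1 ^+ 2 * \sum_a \sum_b g (sdist h X a b) * q a b)); last first.
  rewrite /energy mulr_sumr -big_split/=; apply: ler_sum => a _.
  by rewrite mulr_sumr -big_split/=; apply: ler_sum => b _; exact: tang.
rewrite lerD2l -mulrA ler_wpM2l ?sqr_ge0//.
have -> : \sum_a \sum_b g (sdist h X a b) * q a b =
    2 * \sum_b g (sdist h X i b) * q i b.
  rewrite (bigD1 i)//= mulr2n mulrDl mul1r; congr (_ + _).
  transitivity (\sum_(a | a != i) g (sdist h X i a) * q i a).
    apply: eq_bigr => a ai; rewrite (bigD1 i)//= big1 ?addr0.
      by rewrite sdistC qC.
    by move=> b bi; rewrite q0// mulr0.
  by rewrite [RHS](bigD1 i)//= qii mulr0 add0r.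
(* The term [b = i] is 0 on the right, but in [mean_shift_decrease] it is [- g 0] times the squared
   displacement; hence only an inequality. *)
have le1 : wsum h X i * sqn (displ h X i) <= \sum_b g (sdist h X i b) * q i b.
  rewrite -mean_shift_decrease; apply: ler_sum => b _.
  rewrite ler_wpM2l ?slope_sdist_ge0// /q /update eqxx.
  case: eqP => [->|_//]; rewrite !subrr sqn0.
  by have := sqn_ge0 (mean_shift k h (X i) X - X i); lra.
have le2 : g 0 * sqn (displ h X i) <= wsum h X i * sqn (displ h X i).
  by rewrite ler_wpM2r ?sqn_ge0 ?wsum_ge.
have : 0 <= g 0 * sqn (displ h X i) by rewrite mulr_ge0 ?sqn_ge0 ?slope_ge0.
by lra.
Qed.

(** Minus the derivative of the energy at [e = 0] when [h^-1 ^+ 2] is multiplied by [1 + e]. *)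
Definition band_drift h X : R :=
  \sum_i \sum_j g (sdist h X i j) * sdist h X i j.

(** Tangents at the old scaled distances. The correction is linear in [e], so a random [e] of
    conditional mean 0 given [h] and [X] costs nothing on average. *)
Lemma energy_band h h' X (e : R) : h'^-1 ^+ 2 = (1 + e) * h^-1 ^+ 2 ->
  energy h X - band_drift h X * e <= energy h' X.
Proof.
move=> hE; rewrite /energy /band_drift mulr_suml -sumrB; apply: ler_sum => i _.
rewrite mulr_suml -sumrB; apply: ler_sum => j _.
have := profile_tangent hk (sdist_ge0 h X i j) (sdist_ge0 h' X i j).
have -> : sdist h' X i j = (1 + e) * sdist h X i j by rewrite /sdist hE -mulrA.
by lra.
Qed.

Lemma sum2_bound (F : 'I_n -> 'I_n -> R) (c : R) : (forall i j, F i j <= c) ->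
  \sum_i \sum_j F i j <= n%:R ^+ 2 * c.
Proof.
move=> Fc; apply: (@le_trans _ _ (\sum_(i < n) \sum_(j < n) c)).
  by apply: ler_sum => i _; exact: ler_sum.
by rewrite !sumr_const !card_ord -mulrnA -[leLHS]mulr_natl natrM expr2.
Qed.

Lemma energy_ge0 h X : 0 <= energy h X.
Proof.
by do 2 (apply: sumr_ge0 => ? _); apply: profile_ge0 => //; exact: sdist_ge0.
Qed.

Lemma energy_bound h X : energy h X <= n%:R ^+ 2 * k 0.
Proof. by apply: sum2_bound => i j; apply: profile_le0 => //; exact: sdist_ge0. Qed.

Lemma band_drift_ge0 h X : 0 <= band_drift h X.
Proof.
by do 2 (apply: sumr_ge0 => ? _); rewrite mulr_ge0 ?slope_sdist_ge0 ?sdist_ge0.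
Qed.

Lemma band_drift_bound h X : band_drift h X <= n%:R ^+ 2 * k 0.
Proof. by apply: sum2_bound => i j; apply: slopeM_le => //; exact: sdist_ge0. Qed.

(** Pair [wsum_displ] with [X i], sum over [i], and symmetrise in [i] and [j]: as the weights are
    symmetric, the differences combine into squares. *)
Lemma dissipation h X :
  \sum_i \sum_j g (sdist h X i j) * sqn (X i - X j) =
  - 2 * \sum_i \sum_l wsum h X i * displ h X i ord0 l * X i ord0 l.
Proof.
pose a i j l := g (sdist h X i j) * (X j ord0 l - X i ord0 l) * X i ord0 l.
have -> : \sum_i \sum_l wsum h X i * displ h X i ord0 l * X i ord0 l =
    \sum_i \sum_j \sum_l a i j l.
  apply: eq_bigr => i _; rewrite exchange_big/=; apply: eq_bigr => l _.
  by rewrite wsum_displ mulr_suml.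
have aC : \sum_i \sum_j \sum_l a i j l = \sum_i \sum_j \sum_l a j i l.
  by rewrite exchange_big.
rewrite mulNr mulr2n mulrDl !mul1r {2}aC -!big_split/= -sumrN.
apply: eq_bigr => i _; rewrite -!big_split/= -sumrN.
apply: eq_bigr => j _; rewrite -!big_split/= -sumrN /sqn mulr_sumr.
by apply: eq_bigr => l _; rewrite /a (sdistC h X j i) !mxE; ring.
Qed.

(** The double sum has nonnegative terms, so it dominates the one of [i] and [j]; [n%:R * g 0]
    bounds a total weight and [C] the coordinates. Small displacements thus force each pair to be
    close or nearly weightless. *)
Lemma dissipation_bound h X i j (C : R) : (forall a l, `|X a ord0 l| <= C) ->
  g (sdist h X i j) * sqn (X i - X j) <=
  2 * (n%:R * g 0 * C) * \sum_a \sum_l `|displ h X a ord0 l|.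
Proof.
move=> XC.
apply: (@le_trans _ _ (\sum_a \sum_b g (sdist h X a b) * sqn (X a - X b))).
  have p0 a b : 0 <= g (sdist h X a b) * sqn (X a - X b).
    by rewrite mulr_ge0 ?slope_sdist_ge0 ?sqn_ge0.
  rewrite (bigD1 i)//= (bigD1 j)//= -addrA lerDl addr_ge0//.
    by apply: sumr_ge0 => b _.
  by apply: sumr_ge0 => a _; apply: sumr_ge0.
rewrite dissipation mulNr -mulrN -mulrA ler_pM2l// -sumrN mulr_sumr.
apply: ler_sum => a _; rewrite -sumrN mulr_sumr; apply: ler_sum => l _.
apply: (le_trans (ler_norm _)); rewrite normrN !normrM.
rewrite (gtr0_norm (wsum_gt0 h X a)) mulrAC ler_wpM2r// ler_pM//.
  exact/ltW/wsum_gt0.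
exact: wsum_le.
Qed.

End MeanShift.

(** * Formation of the clusters *)

(** Each class is represented by the element that [pick] chooses in it; the labels are the ranks of
    the representatives, so every label is attained. *)
Lemma equivalence_labelling (n : nat) (r : rel 'I_n) : equivalence_rel r ->
  exists (M : nat) (c : 'I_n -> 'I_M),
    (forall l, exists i, c i = l) /\ (forall i j, r i j <-> c i = c j).
Proof.
move=> r_eq.
pose rep i := odflt i [pick j | r i j].
have rrep i : r i (rep i).
  rewrite /rep; case: pickP => [//|/(_ i)]; by case: (r_eq i i i) => ->.
have repE i j : r i j <-> rep i = rep j.
  split=> [rij|rij].
    rewrite /rep; have -> : [pick x | r i x] = [pick x | r j x].
      by apply: eq_pick => x; case: (r_eq i j x) => _ ->.
    by case: pickP => [//|/(_ j)]; case: (r_eq j j j) => ->.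
  have [rii rt] := r_eq i (rep i) j; rewrite (rt (rrep i)) rij.
  by have [_ rt'] := r_eq j (rep j) j; rewrite -(rt' (rrep j)) (r_eq j j j).1.
pose A := rep @: [set: 'I_n]%SET.
have repA i : rep i \in A by apply: imset_f.
exists #|A|, (fun i => enum_rank_in (repA i) (rep i)).
have enumE i j : enum_rank_in (repA i) (rep i) = enum_rank_in (repA j) (rep j) <->
    rep i = rep j.
  split=> [/(congr1 enum_val)|rij]; first by rewrite !enum_rankK_in.
  by apply: enum_val_inj; rewrite !enum_rankK_in.
split=> [l|i j]; last by rewrite repE enumE.
have /imsetP[i _ li] := enum_valP l; exists i.
by apply: enum_val_inj; rewrite enum_rankK_in.
Qed.

(** * From a gap in the squared distances to fixed clusters *)

Section Clusters.
Variables (R : realType) (n : nat) (h tau : R) (s : nat -> 'I_n -> 'I_n -> R).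
Hypotheses (tau0 : 0 < tau) (tauh : tau < h / 2).
Hypothesis s_ge0 : forall m i j, 0 <= s m i j.
Hypothesis s_refl : forall m i, s m i i = 0.
Hypothesis s_sym : forall m i j, s m i j = s m j i.
Hypothesis s_tri : forall m i j l, s m i l <= 2 * s m i j + 2 * s m j l.
Hypothesis s_gap : forall e, 0 < e -> e < h -> exists K, forall m, (K <= m)%N ->
  forall i j, s m i j < e ^+ 2 \/ (h - e) ^+ 2 < s m i j.
Hypothesis s_step : forall e, 0 < e -> exists K, forall m, (K <= m)%N ->
  forall i j, `|s m.+1 i j - s m i j| < e.

(* No pair can jump over the gap once the steps are shorter than the gap, so
   the relation "[s m i j] is below the gap" no longer changes. *)
Lemma gap_clusters : exists (M : nat) (c : 'I_n -> 'I_M),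
  (forall l, exists i, c i = l) /\
  (exists K, forall m, (K <= m)%N ->
    (forall i j, c i = c j -> s m i j < tau ^+ 2) /\
    (forall i j, c i <> c j -> (h - tau) ^+ 2 < s m i j)) /\
  (forall i j, c i = c j -> (fun m => s m i j) @ \oo --> 0).
Proof.
have [tau0' tauh'] := (tau0, tauh).
have sq_lt (a b : R) : 0 < a -> a < b -> a ^+ 2 < b ^+ 2.
  by move=> a0 ab; rewrite ltr_pXn2r// ?nnegrE; lra.
(* Here [tau < h / 2] enters; the width of this gap is the step size not to be exceeded. *)
have gap : tau ^+ 2 < (h - tau) ^+ 2 by apply: sq_lt; lra.
have [K1 hK1] := s_gap tau0 ltac:(lra).
have [K2 hK2] := @s_step ((h - tau) ^+ 2 - tau ^+ 2) ltac:(lra).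
pose K := maxn K1 K2.
have dich m i j : (K <= m)%N -> s m i j < tau ^+ 2 \/ (h - tau) ^+ 2 < s m i j.
  by move=> Km; apply: hK1; apply: leq_trans Km; exact: leq_maxl.
have step m i j : (K <= m)%N -> `|s m.+1 i j - s m i j| < (h - tau) ^+ 2 - tau ^+ 2.
  by move=> Km; apply: hK2; apply: leq_trans Km; exact: leq_maxr.
pose r : rel 'I_n := fun i j => s K i j < tau ^+ 2.
have near_stays i j m : (K <= m)%N -> r i j -> s m i j < tau ^+ 2.
  move=> /subnK <- rij; elim: (m - K)%N => [//|p IH].
  have Kp : (K <= p + K)%N by exact: leq_addl.
  have := step (p + K)%N i j Kp; have := dich (p + K).+1 i j (leqW Kp).
  by rewrite ltr_norml addSn => -[//|big] /andP[_]; lra.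
have far_stays i j m : (K <= m)%N -> ~~ r i j -> (h - tau) ^+ 2 < s m i j.
  move=> /subnK <- rij; elim: (m - K)%N => [|p IH].
    by case: (dich K i j (leqnn _)) => // small; rewrite /r small in rij.
  have Kp : (K <= p + K)%N by exact: leq_addl.
  have := step (p + K)%N i j Kp; have := dich (p + K).+1 i j (leqW Kp).
  by rewrite ltr_norml addSn => -[small|//] /andP[]; lra.
have r_small i j e : r i j -> 0 < e ->
    exists K', forall m, (K' <= m)%N -> s m i j < e.
  move=> rij e0.
  (* With [e' <= tau] the far alternative of [s_gap] contradicts [near_stays]; with [e' ^+ 2 <= e]
     the near one is the claim. *)
  pose e' := Num.min tau (Num.sqrt e).
  have e'0 : 0 < e' by rewrite lt_min tau0 sqrtr_gt0.
  have e't : e' <= tau by rewrite ge_min lexx.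
  have e'e : e' ^+ 2 <= e.
    rewrite -[leRHS]sqr_sqrtr; last exact: ltW.
    by rewrite ler_pXn2r ?nnegrE ?sqrtr_ge0 ?(ltW e'0)// ge_min lexx orbT.
  have [K' hK'] := s_gap e'0 ltac:(lra).
  exists (maxn K K') => m; rewrite geq_max => /andP[Km K'm].
  case: (hK' m K'm i j) => [|big]; first by move=> h1; exact: lt_le_trans e'e.
  have := near_stays i j m Km rij.
  have : (h - tau) ^+ 2 <= (h - e') ^+ 2 by rewrite ler_pXn2r// ?nnegrE; lra.
  by lra.
have r_far i j : (forall e, 0 < e -> exists K', forall m, (K' <= m)%N ->
    s m i j < e) -> r i j.
  move=> sm; apply: contraT => nrij.
  have [K' hK'] := sm (tau ^+ 2) ltac:(exact: exprn_gt0).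
  have := hK' (maxn K K') (leq_maxr _ _).
  by have := far_stays i j (maxn K K') (leq_maxl _ _) nrij; lra.
have rr : reflexive r by move=> i; rewrite /r s_refl exprn_gt0.
have rs : symmetric r by move=> i j; rewrite /r s_sym.
(* At the fixed threshold [s_tri] gives only [4 * tau ^+ 2], which may exceed the gap. Instead both
   distances tend to 0, hence so does the third, and [r_far] concludes. *)
have rt : transitive r.
  move=> j i l rij rjl; apply: r_far => e e0.
  have [Ka ha] := r_small i j (e / 4) rij ltac:(lra).
  have [Kb hb] := r_small j l (e / 4) rjl ltac:(lra).
  exists (maxn Ka Kb) => m; rewrite geq_max => /andP[/ha h1 /hb h2].
  by have := s_tri m i j l; lra.
have [|M [c [csurj rc]]] := @equivalence_labelling n r.
  move=> i j l; split=> // rij; apply/idP/idP => h1; last exact: rt h1.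
  by apply: rt h1; rewrite rs.
exists M, c; split=> //; split.
  exists K => m Km; split=> i j; first by move/rc; exact: near_stays.
  by move=> cij; apply: far_stays => //; apply/negP => /rc.
move=> i j /rc rij; apply/cvgrPdist_lt => e e0.
have [K' hK'] := r_small i j e rij e0.
exists K' => // m /= /hK'; by rewrite sub0r normrN ger0_norm.
Qed.

End Clusters.

(** * Clusters along one trajectory with vanishing displacements *)

Section SmallDisplacement.
Variables (R : realType) (k : R -> R) (n d : nat) (hmin hmax tau C : R).
Variables (X : nat -> 'I_n -> 'rV[R]_d) (h : nat -> R) (I : nat -> 'I_n).
Hypothesis hk : is_profile k.
Hypotheses (hmin0 : 0 < hmin) (tau0 : 0 < tau) (tauh : tau < hmin / 2).
Hypothesis hI : forall m, hmin <= h m <= hmax.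
Hypothesis XS : forall m, X m.+1 = update k (h m) (X m) (I m).
Hypothesis XC : forall m i l, `|X m i ord0 l| <= C.
Hypothesis displ0 : forall i, (fun m => sqn (displ k (h m) (X m) i)) @ \oo --> 0.

(** All points count here, not only the one that moves at time [m]: the dissipation identity
    involves every displacement. *)
Let L m := \sum_i \sum_l `|displ k (h m) (X m) i ord0 l|.

Let L_cvg0 : L @ \oo --> 0.
Proof.
have -> : 0 = \sum_(i < n) \sum_(l < d) 0 :> R by rewrite big1// => i _; rewrite big1.
rewrite /L; apply: cvg_big => [|i _]; first exact: add_continuous.
apply: cvg_big => [|l _]; first exact: add_continuous.
apply: (@squeeze_cvgr _ _ _ _ (fun=> 0)
  (fun m => Num.sqrt (sqn (displ k (h m) (X m) i)))).
- near=> m; rewrite normr_ge0/=.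
  exact: coord_le_eucnorm.
- exact: cvg_cst.
- rewrite -[X in _ --> X]sqrtr0; apply: continuous_cvg; first exact: sqrt_continuous.
  exact: displ0.
Unshelve. all: by end_near. Qed.

Let L_small e : 0 < e -> exists K, forall m, (K <= m)%N -> L m < e.
Proof.
move=> e0; move/cvgrPdist_lt : L_cvg0 => /(_ e e0)[K _ hK].
exists K => m /hK /=; rewrite sub0r normrN; exact/le_lt_trans/ler_norm.
Qed.

Let L_ge m i : \sum_l `|displ k (h m) (X m) i ord0 l| <= L m.
Proof.
rewrite /L [leRHS](bigD1 i)//= lerDl.
by apply: sumr_ge0 => j _; apply: sumr_ge0.
Qed.

Let step_coord m i l : `|X m.+1 i ord0 l - X m i ord0 l| <=
  `|displ k (h m) (X m) i ord0 l|.
Proof.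
rewrite XS /update /displ; case: eqP => [<-|_]; last by rewrite subrr normr0.
by rewrite [in leRHS]mxE [X in _ <= `|_ + X|]mxE.
Qed.

(** In each coordinate a difference of squares factors: the sum is at most [4 * |C|], the difference
    at most the displacements of [i] and [j], and each of these adds up to at most [L m]. *)
Let sqn_step m i j :
  `|sqn (X m.+1 i - X m.+1 j) - sqn (X m i - X m j)| <= 8 * `|C| * L m.
Proof.
rewrite /sqn -sumrB; apply: le_trans (ler_norm_sum _ _ _) _.
apply: (@le_trans _ _ (\sum_l 4 * `|C| * (`|displ k (h m) (X m) i ord0 l| +
    `|displ k (h m) (X m) j ord0 l|))).
  apply: ler_sum => l _; have := step_coord m j l; have := step_coord m i l.
  move: `|displ _ _ _ _ _ _| `|displ _ _ _ _ _ _| => Di Dj stepi stepj.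
  rewrite !mxE subr_sqr normrM mulrC ler_pM//.
    have := XC m i l; have := XC m j l; have := XC m.+1 i l; have := XC m.+1 j l.
    have := ler_norm C.
    move: `|C| => C' CC'; rewrite !ler_norml.
    by move=> /andP[? ?] /andP[? ?] /andP[? ?] /andP[? ?]; lra.
  apply: le_trans (lerD stepi stepj).
  apply: le_trans (ler_normB _ _); rewrite le_eqVlt; apply/orP; left.
  by apply/eqP; congr `| _ |; ring.
rewrite -mulr_sumr big_split/=.
have -> : 8 * `|C| * L m = 4 * `|C| * (L m + L m) by ring.
by rewrite ler_wpM2l ?mulr_ge0// lerD.
Qed.

(** A distance between [e] and [hmin - e] has scaled square at most [t < 1] for every admissible
    bandwidth, so its weight is at least [slope k t > 0]. The dissipation is then bounded below,
    against [L_small]. *)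
Let gap e : 0 < e -> e < hmin -> exists K, forall m, (K <= m)%N -> forall i j,
  sqn (X m i - X m j) < e ^+ 2 \/ (hmin - e) ^+ 2 < sqn (X m i - X m j).
Proof.
move=> e0 eh; have hmin0' := hmin0.
have hmax0 : 0 < hmax by have /andP[] := hI 0%N; lra.
have hmm : hmin <= hmax by have /andP[] := hI 0%N; lra.
pose t := (1 - e / hmax) ^+ 2.
have ehm : 0 < e / hmax by rewrite divr_gt0.
have ehm1 : e / hmax < 1 by rewrite ltr_pdivrMr//; lra.
have gt0 : 0 < slope k t.
  apply: slope_gt0 => //; rewrite /t ?sqr_ge0// -[ltRHS](expr1n _ 2).
  by rewrite ltr_pXn2r ?nnegrE//; lra.
(* The constant of [dissipation_bound]; adding 1 makes it positive, so that it can be divided by. *)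
pose B := 2 * (n%:R * slope k 0 * `|C|) + 1.
have B0 : 0 < B.
  by rewrite ltr_wpDl// ?mulr_ge0// slope_ge0.
have [|K hK] := @L_small (e ^+ 2 * slope k t / B).
  by rewrite divr_gt0 ?mulr_gt0 ?exprn_gt0.
exists K => m Km i j.
have [?|e1] := ltP (sqn (X m i - X m j)) (e ^+ 2); first by left.
right; rewrite ltNge; apply/negP => e2.
have hm0 : 0 < h m by have /andP[] := hI m; lra.
have := hK m Km; rewrite ltr_pdivlMr// ltNge => /negP; apply.
have sdt : sdist (h m) (X m) i j <= t.
  rewrite /sdist /t; apply: (@le_trans _ _ ((h m)^-1 ^+ 2 * (hmin - e) ^+ 2)).
    by rewrite ler_wpM2l ?sqr_ge0.
  rewrite -exprMn ler_pXn2r ?nnegrE ?mulr_ge0 ?invr_ge0//; try lra.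
  rewrite mulrC ler_pdivrMr// mulrBl mul1r.
  have /andP[h1 h2] := hI m.
  have : e / hmax * h m <= e by rewrite mulrAC ler_pdivrMr// ler_pM2l.
  by lra.
have L0 : 0 <= L m by apply: sumr_ge0 => a _; apply: sumr_ge0.
apply: (@le_trans _ _ (slope k (sdist (h m) (X m) i j) * sqn (X m i - X m j))).
  rewrite mulrC; apply: ler_pM; [exact: ltW|exact: sqr_ge0| |exact: e1].
  by apply: slope_nincr => //; exact: sdist_ge0.
have XC' a l : `|X m a ord0 l| <= `|C| by apply: le_trans (ler_norm _).
by apply: le_trans (dissipation_bound hk (h m) i j XC') _; rewrite -/(L m) /B; lra.
Qed.

Lemma displ_clusters : exists (M : nat) (c : 'I_n -> 'I_M),
  (forall l : 'I_M, exists i, c i = l) /\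
  (exists K : nat, forall m, (K <= m)%N ->
     (forall i j, c i = c j -> eucdist (X m i) (X m j) < tau) /\
     (forall i j, c i <> c j -> hmin - tau < eucdist (X m i) (X m j))) /\
  (forall i j, c i = c j -> (fun m => eucdist (X m i) (X m j)) @ \oo --> 0).
Proof.
have [tau0' tauh'] := (tau0, tauh).
have [] := @gap_clusters R n hmin tau (fun m i j => sqn (X m i - X m j)) tau0 tauh.
- by move=> m i j; exact: sqn_ge0.
- by move=> m i; rewrite subrr sqn0.
- by move=> m i j; exact: sqnBC.
- move=> m i j l; apply: le_trans (sqnD_le _ _).
  by rewrite addrA subrK.
- exact: gap.
- move=> e e0; have B0 : 0 < 8 * `|C| + 1 by have := normr_ge0 C; lra.
  have [|K hK] := @L_small (e / (8 * `|C| + 1)); first by rewrite divr_gt0.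
  exists K => m /hK; rewrite ltr_pdivlMr// => Le i j.
  apply: le_lt_trans (sqn_step m i j) _; apply: le_lt_trans Le.
  have L0 : 0 <= L m by apply: sumr_ge0 => a _; apply: sumr_ge0.
  by lra.
move=> M [c [csurj [[K hK] c0]]]; exists M, c; split=> //; split.
  exists K => m Km; have [h1 h2] := hK m Km; split=> i j.
    move=> /h1; rewrite -/(sqn _) /eucdist -eucnorm_sqr.
    by rewrite ltr_pXn2r ?nnegrE ?sqrtr_ge0// ltW.
  move=> /h2; rewrite /eucdist -eucnorm_sqr.
  by rewrite ltr_pXn2r ?nnegrE ?sqrtr_ge0//; lra.
move=> i j /c0 sc; rewrite /eucdist /eucnorm.
rewrite -[X in _ --> X]sqrtr0; apply: continuous_cvg; last exact: sc.
exact: sqrt_continuous.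
Qed.

End SmallDisplacement.

(** * Bandwidths, states and their measurability *)

Section Bandwidth.
Variables (R : realType) (hmin hmax h1 : R) (nu U : nat -> R).
Hypotheses (hmin0 : 0 < hmin) (hminmax : hmin < hmax).
Hypotheses (h1min : hmin <= h1) (h1max : h1 <= hmax).
Hypothesis nu0 : forall m, 0 <= nu m.
Hypothesis U1 : forall m, `|U m| <= 1.

Local Notation band := (dsms_band hmin hmax h1 nu U).
Local Notation delta m := (dsms_delta hmin hmax (nu m.+1) (band m)).

Lemma dsms_delta_ge0 (h v : R) : 0 <= v -> hmin <= h <= hmax ->
  0 <= dsms_delta hmin hmax v h.
Proof.
have [p1 p2] := (hmin0, hminmax); move=> v0 /andP[hl hu].
rewrite !le_min v0 !subr_ge0 /=; apply/andP; split.
  by rewrite exprn_ege1// ler_pdivlMr// mul1r.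
by rewrite exprn_ile1// ?ler_pdivrMr ?mul1r ?divr_ge0//; lra.
Qed.

(** The last two terms of the minimum in [dsms_delta] are exactly the room that keeps
    [h / sqrt alpha] between [hmin] and [hmax]. *)
Lemma dsms_alpha_bounds (h v u : R) : 0 <= v -> hmin <= h <= hmax -> `|u| <= 1 ->
  (h / hmax) ^+ 2 <= 1 + dsms_delta hmin hmax v h * u <= (h / hmin) ^+ 2.
Proof.
move=> v0 hh; rewrite ler_norml => /andP[Ul Uu].
have := dsms_delta_ge0 v0 hh; set de := dsms_delta _ _ _ _ => de0.
have dU : - de <= de * u <= de.
  by rewrite -{1}(mulr1 de) -mulrN -{4}(mulr1 de) !ler_wpM2l.
have de1 : de <= (h / hmin) ^+ 2 - 1 by rewrite /de /dsms_delta !ge_min lexx !orbT.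
have de2 : de <= 1 - (h / hmax) ^+ 2 by rewrite /de /dsms_delta !ge_min lexx !orbT.
by apply/andP; lra.
Qed.

Lemma dsms_band_bounds m : hmin <= band m <= hmax.
Proof.
have [p1 p2] := (hmin0, hminmax).
elim: m => [|m IH] /=; first by rewrite h1min h1max.
have := dsms_alpha_bounds (nu0 m.+1) IH (U1 m.+1).
set h := band m in IH *; have /andP[hl hu] := IH.
set a := 1 + _ => /andP[a2 a1].
have h0 : 0 < h by lra.
have hm0 : 0 < hmax by lra.
have a0 : 0 < a by apply: lt_le_trans a2; rewrite exprn_gt0// divr_gt0.
have s0 : 0 < Num.sqrt a by rewrite sqrtr_gt0.
have q1 : 0 < h / hmin by rewrite divr_gt0.
have q2 : 0 < h / hmax by rewrite divr_gt0.
have s1 : Num.sqrt a <= h / hmin.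
  by rewrite -(gtr0_norm q1) -sqrtr_sqr ler_sqrt ?sqr_ge0.
have s2 : h / hmax <= Num.sqrt a.
  by rewrite -(gtr0_norm q2) -sqrtr_sqr ler_sqrt// ltW.
apply/andP; split.
  by rewrite ler_pdivlMr// mulrC -ler_pdivlMr.
by rewrite ler_pdivrMr// mulrC -ler_pdivrMr.
Qed.

(** Because of the square root, the inverse squared bandwidth is multiplied by [alpha] itself, which
    is the form [energy_band] asks for. *)
Lemma dsms_band_step m :
  (band m.+1)^-1 ^+ 2 = (1 + delta m * U m.+1) * (band m)^-1 ^+ 2.
Proof.
have /andP[a2 _] := dsms_alpha_bounds (nu0 m.+1) (dsms_band_bounds m) (U1 m.+1).
rewrite /= invfM invrK mulrC exprMn sqr_sqrtr//.
by apply: le_trans a2; exact: sqr_ge0.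
Qed.

End Bandwidth.

Lemma dsms_stateS (R : realType) (k : R -> R) (d n : nat) (hmin hmax h1 : R)
    (nu U : nat -> R) (I : nat -> 'I_n) (X0 : 'I_n -> 'rV[R]_d) (m : nat) :
  dsms_state k hmin hmax h1 nu U I X0 m.+1 =
  update k (dsms_band hmin hmax h1 nu U m)
    (dsms_state k hmin hmax h1 nu U I X0 m) (I m).
Proof. by []. Qed.

Lemma dsms_state_bound (R : realType) (k : R -> R) (d n : nat) (hmin hmax h1 : R)
    (nu U : nat -> R) (I : nat -> 'I_n) (X0 : 'I_n -> 'rV[R]_d) m i l :
  is_profile k ->
  `|dsms_state k hmin hmax h1 nu U I X0 m i ord0 l| <=
  \sum_a \sum_b `|X0 a ord0 b|.
Proof.
move=> hk; elim: m i => [|m IH] i.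
  rewrite [leRHS](bigD1 i)//= [X in _ <= X + _](bigD1 l)//= -addrA lerDl addr_ge0//.
    exact: sumr_ge0.
  by do 2 (apply: sumr_ge0 => ? _).
rewrite dsms_stateS /update; case: eqP => // _.
exact: mean_shift_bound.
Qed.

(** * Measurability of one step and of the energy *)

Section Measurability.
Variables (dT : measure_display) (T : measurableType dT) (R : realType).
Implicit Types f : T -> R.

(** The inverse is [x] times the real power [-1] of its square; at 0 both sides are 0 because the
    inverse of 0 is 0. *)
Lemma measurable_fun_invr f : measurable_fun setT f ->
  measurable_fun setT (fun w => (f w)^-1).
Proof.
move=> mf.
have -> : (fun w => (f w)^-1) = (fun w => f w * (f w ^+ 2) `^ (-1)).
  apply/funext => w; rewrite powR_inv1 ?sqr_ge0//.
  have [->|f0] := eqVneq (f w) 0; first by rewrite invr0 mul0r.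
  by rewrite expr2 invfM mulVKf.
apply: measurable_funM => //.
apply: (@measurableT_comp _ _ _ _ _ _ (@powR R ^~ (-1))).
  exact: measurable_powR.
exact: measurable_funX.
Qed.

Variables (k : R -> R) (n d : nat).
Hypothesis hk : is_profile k.

Lemma measurable_profile : measurable_fun setT k.
Proof.
apply: continuous_measurable_fun => t; case: hk => -[kd _] _.
exact/differentiable_continuous/derivable1_diffP.
Qed.

Lemma measurable_slope : measurable_fun setT (slope k).
Proof.
apply: measurableT_comp => //; apply: continuous_measurable_fun.
by case: hk => -[].
Qed.

Variables (h : T -> R) (X : T -> 'I_n -> 'rV[R]_d).
Hypothesis mh : measurable_fun setT h.
Hypothesis mX : forall i l, measurable_fun setT (fun w => X w i ord0 l).

Lemma measurable_sdist i j : measurable_fun setT (fun w => sdist (h w) (X w) i j).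
Proof.
apply: measurable_funM; first exact/measurable_funX/measurable_fun_invr.
apply: measurable_sum => l; apply: measurable_funX.
under eq_fun do rewrite !mxE.
exact: measurable_funB.
Qed.

Lemma measurable_slope_sdist i j :
  measurable_fun setT (fun w => slope k (sdist (h w) (X w) i j)).
Proof. exact/(measurableT_comp measurable_slope)/measurable_sdist. Qed.

Lemma measurable_mean_shift i l :
  measurable_fun setT (fun w => mean_shift k (h w) (X w i) (X w) ord0 l).
Proof.
under eq_fun do rewrite mean_shift_coord.
apply: measurable_funM.
  apply: measurable_fun_invr; apply: measurable_sum => j.
  exact: measurable_slope_sdist.
apply: measurable_sum => j; apply: measurable_funM => //.
exact: measurable_slope_sdist.
Qed.

Lemma measurable_sqn_displ i :
  measurable_fun setT (fun w => sqn (displ k (h w) (X w) i)).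
Proof.
apply: measurable_sum => l; apply: measurable_funX.
rewrite (_ : (fun w => _) = (fun w => mean_shift k (h w) (X w i) (X w) ord0 l
    - X w i ord0 l)); first exact/measurable_funB/mX/measurable_mean_shift.
by apply/funext => w; rewrite mxE [X in _ + X]mxE.
Qed.

Lemma measurable_energy : measurable_fun setT (fun w => energy k (h w) (X w)).
Proof.
do 2 (apply: measurable_sum => ?).
exact/(measurableT_comp measurable_profile)/measurable_sdist.
Qed.

Lemma measurable_band_drift :
  measurable_fun setT (fun w => band_drift k (h w) (X w)).
Proof.
do 2 (apply: measurable_sum => ?).
apply: measurable_funM; [exact: measurable_slope_sdist|exact: measurable_sdist].
Qed.

End Measurability.

(** * Measurability of the process *)

Section MeasurableProcess.
Variables (dT : measure_display) (T : measurableType dT) (R : realType).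
Variables (k : R -> R) (n d : nat) (hmin hmax h1 : R) (nu : nat -> R).
Variables (X0 : 'I_n -> 'rV[R]_d) (I : nat -> T -> 'I_n) (U : nat -> T -> R).
Hypothesis hk : is_profile k.

Lemma measurable_dsms_delta (v : R) (f : T -> R) : measurable_fun setT f ->
  measurable_fun setT (fun w => dsms_delta hmin hmax v (f w)).
Proof.
move=> mf; apply: measurable_minr; first exact: measurable_cst.
by apply: measurable_minr; apply: measurable_funB => //;
  apply: measurable_funX; apply: measurable_funM.
Qed.

Lemma measurable_dsms_band m :
  (forall j, (j <= m)%N -> measurable_fun setT (U j)) ->
  measurable_fun setT (fun w => dsms_band hmin hmax h1 nu (U ^~ w) m).
Proof.
elim: m => [|m IH] mU /=; first exact: measurable_cst.
have mb : measurable_fun setT (fun w => dsms_band hmin hmax h1 nu (U ^~ w) m).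
  by apply: IH => j jm; apply: mU; exact: leqW.
apply: measurable_funM => //; apply: measurable_fun_invr.
apply: (measurableT_comp (continuous_measurable_fun (@sqrt_continuous R))).
apply: measurable_funD => //; apply: measurable_funM; last exact: mU.
exact: measurable_dsms_delta.
Qed.

(** Only noise before time [m] is assumed measurable, so that [T] may carry the sigma-algebra of a
    finite past. *)
Lemma measurable_dsms_state m i l :
  (forall j a, (j < m)%N -> measurable [set w | I j w = a]) ->
  (forall j, (j < m)%N -> measurable_fun setT (U j)) ->
  measurable_fun setT (fun w =>
    dsms_state k hmin hmax h1 nu (U ^~ w) (I ^~ w) X0 m i ord0 l).
Proof.
elim: m i l => [|m IH] i l mI mU; first exact: measurable_cst.
have mX a b : measurable_fun setT (fun w =>
    dsms_state k hmin hmax h1 nu (U ^~ w) (I ^~ w) X0 m a ord0 b).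
  by apply: IH => j ? *; [apply: mI|apply: mU]; exact: leqW.
have mb : measurable_fun setT (fun w => dsms_band hmin hmax h1 nu (U ^~ w) m).
  by apply: measurable_dsms_band => j jm; apply: mU.
(* In the branch where [I m w] equals [i], the random index is replaced by the fixed [i]. *)
rewrite (_ : (fun w => _) = (fun w => if i == I m w then
    mean_shift k (dsms_band hmin hmax h1 nu (U ^~ w) m)
      (dsms_state k hmin hmax h1 nu (U ^~ w) (I ^~ w) X0 m i)
      (dsms_state k hmin hmax h1 nu (U ^~ w) (I ^~ w) X0 m) ord0 l
    else dsms_state k hmin hmax h1 nu (U ^~ w) (I ^~ w) X0 m i ord0 l)); last first.
  apply/funext => w; rewrite dsms_stateS /update.
  by case: eqP => [->|_]; reflexivity.
apply: measurable_fun_ifT => //; last exact: measurable_mean_shift.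
apply: (measurable_fun_bool true); rewrite setTI.
rewrite (_ : _ @^-1` _ = [set w | I m w = i]); first exact: mI.
by apply/seteqP; split=> w /= => [/eqP ->|->] //; rewrite eqxx.
Qed.

End MeasurableProcess.

(** * Independence of the noise from the past *)

Section SubSigmaAlgebra.
Local Open Scope ereal_scope.
Variables (R : realType) (dT : measure_display) (T : measurableType dT).
Variables (P : probability T R) (G : set (set T)).
Hypothesis Gm : G `<=` measurable.
Local Notation GT := (g_sigma_algebraType G).

Lemma sub_sigma_measurable A : <<s G >> A -> measurable A.
Proof. by apply: smallest_sub => //; exact: sigma_algebra_measurable. Qed.

(** The identity onto [T] with the coarser sigma-algebra; pushing a measure forward along it
    restricts the measure to that sigma-algebra. *)
Lemma measurable_coarsen : measurable_fun setT (id : T -> GT).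
Proof. by move=> _ A mA; rewrite setTI; exact: sub_sigma_measurable. Qed.

Lemma measurable_refine d' (T' : measurableType d') (f : GT -> T') :
  measurable_fun setT f -> measurable_fun setT (f : T -> T').
Proof. by move=> mf; exact: (measurableT_comp mf measurable_coarsen). Qed.

Lemma integral_mrestr (mu : {measure set T -> \bar R}) (D : set T)
    (mD : measurable D) (f : T -> \bar R) :
  measurable_fun setT f -> (forall w, 0 <= f w) ->
  \int[mrestr mu mD]_w f w = \int[mu]_(w in D) f w.
Proof.
move=> mf f0; rewrite (@ge0_negligible_integral _ _ _ (mrestr mu mD) setT (~` D))//.
- rewrite setTD setCK; apply: eq_measure_integral => A mA AD.
  by rewrite /= /mrestr setIidl.
- exact: measurableC.
- by rewrite /= /mrestr setICl measure0.
Qed.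

(** Pushed forward along the identity to [GT], [P] restricted to [D] and [c] times [P] are the same
    measure, and [Z] is measurable there. *)
Lemma integral_proportional (D : set T) (mD : measurable D) (c : {nonneg R})
    (Z : GT -> \bar R) :
  (forall A, <<s G >> A -> P (A `&` D) = c%:num%:E * P A) ->
  measurable_fun setT Z -> (forall w, 0 <= Z w) ->
  \int[P]_(w in D) Z w = c%:num%:E * \int[P]_w Z w.
Proof.
move=> PD mZ Z0; have mZ' := measurable_refine mZ.
rewrite -(integral_mrestr _ mD)//.
have push (mu : {measure set T -> \bar R}) :
    \int[mu]_w Z w = \int[pushforward mu (id : T -> GT)]_w Z w.
  by rewrite (ge0_integral_pushforward measurable_coarsen).
rewrite push [X in _ = _ * X]push.
pose mid := isMeasurableFun.Build _ _ _ _ _ measurable_coarsen.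
pose idG : {mfun T >-> GT} := HB.pack (id : T -> GT) mid.
rewrite -[in RHS]/(distribution P idG).
rewrite -ge0_integral_mscale//.
apply: (eq_measure_integral (mscale c (distribution P idG))) => [|mid' A mA _].
  exact: measurable_coarsen.
exact: PD.
Qed.

(** The joint law of the identity to [GT] and [V] agrees with the product measure on rectangles,
    hence is that product; Tonelli then factors the integral. *)
Lemma integral_independent (d2 : measure_display) (T2 : measurableType d2)
    (V : T -> T2) (Q : probability T2 R) (Z : GT -> R) (F : T2 -> R) :
  measurable_fun setT V ->
  (forall A B, <<s G >> A -> measurable B -> P (A `&` V @^-1` B) = P A * Q B) ->
  measurable_fun setT Z -> (forall w, 0 <= Z w)%R ->
  measurable_fun setT F -> (forall x, 0 <= F x)%R ->
  \int[P]_w (Z w * F (V w))%:E = \int[P]_w (Z w)%:E * \int[Q]_x (F x)%:E.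
Proof.
move=> mV PV mZ Z0 mF F0.
pose mid := isMeasurableFun.Build _ _ _ _ _ measurable_coarsen.
pose idG : {mfun T >-> GT} := HB.pack (id : T -> GT) mid.
pose m1 := distribution P idG.
have mW : measurable_fun setT (fun w : T => ((w : GT), V w)).
  by apply: measurable_fun_pair => //; exact: measurable_coarsen.
pose miW := isMeasurableFun.Build _ _ _ _ _ mW.
pose W : {mfun T >-> (GT * T2)%type} := HB.pack (fun w : T => ((w : GT), V w)) miW.
pose f (z : GT * T2) := (Z z.1 * F z.2)%:E.
have mf : measurable_fun setT f.
  apply/measurable_EFinP; apply: measurable_funM.
    exact: (measurableT_comp mZ measurable_fst).
  exact: (measurableT_comp mF measurable_snd).
have f0 z : 0 <= f z by rewrite lee_fin mulr_ge0.
transitivity (\int[distribution P W]_z f z).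
  by rewrite ge0_integral_pushforward.
transitivity (\int[m1 \x Q]_z f z).
  apply: eq_measure_integral => A mA _; apply/esym.
  exact: product_measure_unique.
have inner (x : GT) : \int[Q]_y (Z x * F y)%:E = (Z x)%:E * \int[Q]_y (F y)%:E.
  under eq_integral do rewrite EFinM.
  rewrite ge0_integralZl//.
  - exact/measurable_EFinP.
  - by move=> y _; rewrite lee_fin.
  - by rewrite lee_fin.
transitivity (\int[m1]_x ((Z x)%:E * \int[Q]_y (F y)%:E)).
  by rewrite fubini_tonelli1//; apply: eq_integral => x _; exact: inner.
rewrite ge0_integralZr//.
- rewrite /m1 /distribution (ge0_integral_pushforward measurable_coarsen)//.
  + exact/measurable_EFinP.
  + by move=> y _; rewrite lee_fin.
- exact/measurable_EFinP.
- by move=> y _; rewrite lee_fin.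
- by apply: integral_ge0 => y _; rewrite lee_fin.
Qed.

End SubSigmaAlgebra.

(** * The uniform law on (-1, 1) *)

Section UniformLaw.
Variable R : realType.

Lemma ltN11 : -1 < 1 :> R. Proof. by lra. Qed.

Local Notation unif := (uniform_prob ltN11).

(** The density lives on the closed interval, [dsms_noise] uses the open one; the two endpoints form
    a null set. *)
Lemma uniform_probE (B : set R) : measurable B ->
  unif B = (lebesgue_measure (B `&` @open_m1_1 R) * (2^-1)%:E)%E.
Proof.
move=> mB; rewrite /uniform_prob integral_uniform_pdf.
have mO : measurable (B `&` @open_m1_1 R).
  by apply: measurableI => //; exact: measurable_itv.
have mE : measurable (B `&` `[-1, 1]).
  by apply: measurableI => //; exact: measurable_itv.
rewrite (eq_integral (fun=> (2^-1)%:E)); last first.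
  move=> x; rewrite inE => -[_]; rewrite /= in_itv/= /uniform_pdf => ->.
  by congr (_^-1)%:E; lra.
rewrite integral_cst// muleC; congr (_ * _)%E.
apply/eqP; rewrite eq_le; apply/andP; split; last first.
  apply: le_measure; rewrite ?inE// => x [Bx]; rewrite /open_m1_1/= !in_itv/=.
  by move=> /andP[x1 x2]; split=> //; rewrite !ltW.
have sub : B `&` `[-1, 1] `<=` (B `&` @open_m1_1 R) `|` ([set -1] `|` [set 1]).
  move=> x [Bx]; rewrite /open_m1_1/= !in_itv/= => /andP[].
  rewrite [-1 <= x]le_eqVlt => /orP[/eqP <-|x1]; first by right; left.
  rewrite le_eqVlt => /orP[/eqP ->|x2]; first by right; right.
  by left; split=> //; rewrite x1 x2.
have mS : measurable ([set -1 : R] `|` [set 1]).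
  by apply: measurableU; exact: measurable_set1.
have S0 : lebesgue_measure ([set -1 : R] `|` [set 1]) = 0%E.
  have L1 (x : R) := @lebesgue_measure_set1 R x.
  by rewrite measureU0; [exact: L1|exact: measurable_set1..|exact: L1].
apply: (@le_trans _ _ (lebesgue_measure
    ((B `&` @open_m1_1 R) `|` ([set -1] `|` [set 1])))).
  by apply: le_measure; rewrite ?inE//; exact: measurableU.
by rewrite measureU0.
Qed.

(* Almost surely [trunc] does not change the noise; it makes the bounds on the
   bandwidths hold for every outcome. *)
Definition trunc (u : R) : R := if `|u| <= 1 then u else 0.

Lemma trunc_le1 u : `|trunc u| <= 1.
Proof. by rewrite /trunc; case: ifP => //; rewrite normr0. Qed.

Lemma measurable_trunc : measurable_fun setT trunc.
Proof.
apply: measurable_fun_ifT => //.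
by apply: measurable_fun_ler => //; exact: measurableT_comp.
Qed.

(** That the noise has mean 0, shifted by 1 to keep the integrand nonnegative. *)
Lemma integral_uniform_trunc : (\int[unif]_x (1 + trunc x)%:E = 1)%E.
Proof.
rewrite integral_uniform; last 2 first.
- apply/measurable_EFinP; apply: measurable_funD => //; exact: measurable_trunc.
- by move=> x; rewrite lee_fin; have := trunc_le1 x; rewrite ler_norml; lra.
rewrite [X in (_ * X)%E](_ : _ =
    (\int[lebesgue_measure]_(x in `[(-1)%R, 1%R]) (1 + (x : R))%:E)%E); last first.
  by apply: eq_integral => x; rewrite inE/= in_itv/= /trunc ler_norml => ->.
pose F (x : R) := x + 2^-1 * x ^+ 2.
have dF (x : R) : is_derive x 1 F (1 + x).
  rewrite /F; apply: is_derive_eq; rewrite /GRing.scale/=; lra.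
rewrite (@continuous_FTC2 R (fun x => 1 + x) F); first last.
- by move=> x _; rewrite derive1E; exact: derive_val.
- have cF x : {for x, continuous F}.
    by apply/differentiable_continuous/derivable1_diffP; case: (dF x).
  split=> [x _| |]; first by case: (dF x).
    exact/cvg_at_right_filter/cF.
  exact/cvg_at_left_filter/cF.
- by apply: continuous_subspaceT => x; apply: cvgD; [exact: cvg_cst|exact: cvg_id].
- by lra.
by rewrite /F -EFinB -EFinM; congr EFin; field.
Qed.

End UniformLaw.

Lemma sume_const_ord (R : realType) (n : nat) (x : \bar R) :
  (\sum_(i < n) x = n%:R%:E * x)%E.
Proof.
elim: n => [|n IH]; first by rewrite big_ord0 mul0e.
by rewrite big_ord_recr IH -natr1 EFinD ge0_muleDl ?lee_fin// mul1e.
Qed.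

(** * Laws of the index and of the noise given the past *)

Section Noise.
Local Open Scope ereal_scope.
Variables (R : realType) (dT : measure_display) (T : measurableType dT).
Variables (P : probability T R) (n : nat).
Variables (I : nat -> T -> 'I_n) (U : nat -> T -> R).
Hypothesis n0 : (0 < n)%N.
Hypothesis hN : dsms_noise P I U.
Local Notation unif := (uniform_prob (ltN11 R)).

(** Two lengths are needed: [I N] is drawn after [U N], so its past is [p = N], [q = N.+1], while
    the past of [U N] is [p = q = N]. *)
Definition cyl p q (a : nat -> 'I_n) (B : nat -> set R) : set T :=
  [set w | (forall j, (j < p)%N -> I j w = a j) /\
           (forall j, (j < q)%N -> B j (U j w))].

(** The empty set is included for closure under intersection: cylinders that prescribe different
    indices are disjoint. *)
Definition cylinders p q : set (set T) :=
  [set A | A = set0 \/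
    exists a B, (forall m, measurable (B m)) /\ A = cyl p q a B].

Definition set_at (V : Type) (f : nat -> V) N v : nat -> V :=
  fun j => if j == N then v else f j.

Lemma measurable_index m a : measurable [set w | I m w = a].
Proof. by case: hN => h _; exact: h. Qed.

Lemma measurable_noise m : measurable_fun setT (U m).
Proof. by case: hN => _ [h _]; exact: h. Qed.

Lemma measurable_cyl p q a B : (forall m, measurable (B m)) ->
  measurable (cyl p q a B).
Proof.
move=> mB.
have -> : cyl p q a B = \bigcap_j
   ((if (j < p)%N then [set w | I j w = a j] else setT) `&`
    (if (j < q)%N then U j @^-1` B j else setT)).
  apply/seteqP; split=> w.
    by move=> [h1 h2] j _; split; case: ifP => // jlt; [exact: h1|exact: h2].
  by move=> h; split=> j jlt; have [] := h j Logic.I; rewrite jlt.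
apply: bigcapT_measurable => j; apply: measurableI; case: ifP => // _.
  exact: measurable_index.
by rewrite -[X in measurable X]setTI; exact: measurable_noise.
Qed.

Lemma cylinders_measurable p q : cylinders p q `<=` measurable.
Proof. by move=> _ [->//|[a [B [mB ->]]]]; exact: measurable_cyl. Qed.

Lemma cylinders_setI p q : setI_closed (cylinders p q).
Proof.
move=> A A' [->|[a [B [mB ->]]]]; first by left; rewrite set0I.
move=> [->|[a' [B' [mB' ->]]]]; first by left; rewrite setI0.
have [aa'|naa'] := pselect (forall j, (j < p)%N -> a j = a' j); last first.
  left; rewrite -subset0 => w [[ha _] [ha' _]]; apply: naa' => j jp.
  by rewrite -ha// ha'.
right; exists a, (fun j => B j `&` B' j); split.
  by move=> m; exact: measurableI.
apply/seteqP; split=> w.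
  by move=> [[ha hB] [ha' hB']]; split=> // j jq; split; [exact: hB|exact: hB'].
move=> [ha hB]; split; split=> // j jq; try by case: (hB j jq).
by rewrite -aa'// ha.
Qed.

(** An enumeration of all finite index sequences, by decoding natural numbers. It yields the
    countable cover by cylinders that uniqueness of measures requires. *)
Definition assignment (k : nat) : nat -> 'I_n :=
  nth (Ordinal n0) (odflt [::] (unpickle k)).

Lemma assignment_surj p (f : nat -> 'I_n) :
  exists k, forall j, (j < p)%N -> assignment k j = f j.
Proof.
exists (pickle (mkseq f p)) => j jp.
by rewrite /assignment pickleK /= nth_mkseq.
Qed.

Lemma cylinders_cover p q : \bigcup_k cyl p q (assignment k) (fun=> setT) = setT.
Proof.
rewrite -subTset => w _.
have [k hk] := assignment_surj p (I ^~ w).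
by exists k => //; split=> // j jp; rewrite hk.
Qed.

(** A cylinder prescribes all the first [p] indices, so an event about one of them is a countable
    union of cylinders. *)
Lemma sigma_cyl_index p q j a : (j < p)%N ->
  <<s cylinders p q >> [set w | I j w = a].
Proof.
move=> jp.
have -> : [set w | I j w = a] = \bigcup_(k in [set k | assignment k j = a])
    cyl p q (assignment k) (fun=> setT).
  apply/seteqP; split=> w /=.
    move=> Ija; have [k hk] := assignment_surj p (I ^~ w).
    exists k; first by rewrite /= hk.
    by split=> // j' jp'; rewrite hk.
  by move=> [k <-] [-> //].
apply: (@bigcup_measurable _ (g_sigma_algebraType (cylinders p q))) => k _.
by apply: sub_sigma_algebra; right; exists (assignment k), (fun=> setT).
Qed.

Lemma sigma_cyl_noise p q j B : (j < q)%N -> measurable B ->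
  <<s cylinders p q >> (U j @^-1` B).
Proof.
move=> jq mB.
have -> : U j @^-1` B = \bigcup_k cyl p q (assignment k) (set_at (fun=> setT) j B).
  apply/seteqP; split=> w /=.
    move=> BU; have [k hk] := assignment_surj p (I ^~ w).
    exists k => //; split=> [j' jp'|j' _]; first by rewrite hk.
    by rewrite /set_at; case: eqP => [->|].
  by move=> [k _] [_ /(_ j jq)]; rewrite /set_at eqxx.
apply: (@bigcup_measurable _ (g_sigma_algebraType (cylinders p q))) => k _.
apply: sub_sigma_algebra; right; exists (assignment k), (set_at (fun=> setT) j B).
by split=> // m; rewrite /set_at; case: eqP.
Qed.

Lemma cyl_prob N a B : (forall m, measurable (B m)) ->
  P (cyl N N a B) = \prod_(m < N) (n%:R^-1%:E * unif (B m)).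
Proof.
move=> mB; case: hN => _ [_ /(_ N a B mB)].
under [X in _ = X -> _]eq_bigr do rewrite -uniform_probE//.
move=> <-; congr (P _); apply/seteqP; split=> w.
  by move=> [h1 h2] j jN; split; [exact: h1|exact: h2].
by move=> h; split=> j jN; case: (h j jN).
Qed.

Lemma cyl_index N a B i : cyl N N.+1 a B `&` [set w | I N w = i] =
  cyl N.+1 N.+1 (set_at a N i) B.
Proof.
apply/seteqP; split=> w.
  move=> [[h1 h2] h3]; split=> // j; rewrite ltnS leq_eqVlt /set_at.
  by case: eqP => [->//|_] /=; exact: h1.
move=> [h1 h2]; split; last by have := h1 N (leqnn _); rewrite /set_at eqxx.
split=> // j jN; rewrite h1; last exact: ltnW.
by rewrite /set_at ltn_eqF.
Qed.

Lemma cyl_noise N a B B' : cyl N N a B `&` U N @^-1` B' =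
  cyl N N.+1 a (set_at B N B').
Proof.
apply/seteqP; split=> w.
  move=> [[h1 h2] h3]; split=> // j; rewrite ltnS leq_eqVlt /set_at.
  by case: eqP => [->//|_] /=; exact: h2.
move=> [h1 h2]; split; last by have := h2 N (leqnn _); rewrite /set_at eqxx.
split=> // j jN; have := h2 j (ltnW jN).
by rewrite /set_at ltn_eqF.
Qed.

Lemma cyl_index_prob N a B i : (forall m, measurable (B m)) ->
  P (cyl N N.+1 a B `&` [set w | I N w = i]) =
  (\prod_(m < N) (n%:R^-1%:E * unif (B m))) * (n%:R^-1%:E * unif (B N)).
Proof.
by move=> mB; rewrite cyl_index cyl_prob// big_ord_recr.
Qed.

(** [dsms_noise] treats equally many indices and noises, so the missing index [I N] is summed out:
    [n] equal terms, each with factor [n%:R^-1]. *)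
Lemma cyl_noise_prob N a B : (forall m, measurable (B m)) ->
  P (cyl N N.+1 a B) = (\prod_(m < N) (n%:R^-1%:E * unif (B m))) * unif (B N).
Proof.
move=> mB.
have mD i : measurable (cyl N N.+1 a B `&` [set w | I N w = i]).
  apply: measurableI; first exact: measurable_cyl.
  exact: measurable_index.
have -> : cyl N N.+1 a B =
    \big[setU/set0]_(i < n) (cyl N N.+1 a B `&` [set w | I N w = i]).
  apply/seteqP; split=> w.
    by move=> cw; rewrite (bigD1 (I N w))//=; left.
  move: w; apply: (big_ind (fun S => S `<=` cyl N N.+1 a B)) => [||i _].
  - exact: sub0set.
  - by move=> S S' hS hS'; rewrite subUset.
  - exact: subIsetl.
rewrite measure_semi_additive_ord//.
- rewrite (eq_bigr (fun=> (\prod_(m < N) (n%:R^-1%:E * unif (B m))) *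
      (n%:R^-1%:E * unif (B N)))); last by move=> i _; exact: cyl_index_prob.
  rewrite sume_const_ord muleCA [X in _ * X]muleA -EFinM.
  by rewrite divff ?mul1e// pnatr_eq0 -lt0n.
- apply/trivIsetP => i j _ _ ij; rewrite -subset0 => w [[_ /= Ii] [_ /= Ij]].
  by move: ij; rewrite -Ii -Ij eqxx.
- exact: bigsetU_measurable.
Qed.

(** Both sides are finite measures in [A] that agree on the cylinders, a family closed under
    intersection that generates the sigma-algebra. *)
Lemma sigma_index_prob N A i : <<s cylinders N N.+1 >> A ->
  P (A `&` [set w | I N w = i]) = n%:R^-1%:E * P A.
Proof.
move=> sA; have mD := measurable_index N i.
have c0 : (0 <= n%:R^-1 :> R)%R by rewrite invr_ge0.
apply: (@g_sigma_algebra_measure_unique _ _ _ (cylinders N N.+1) _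
  (fun k => cyl N N.+1 (assignment k) (fun=> setT)) _ _
  (mrestr P mD) (mscale (NngNum c0) P)) => //.
- exact: cylinders_measurable.
- by move=> k; right; exists (assignment k), (fun=> setT).
- exact: cylinders_cover.
- exact: cylinders_setI.
- move=> _ [->|[a [B [mB ->]]]]; first by rewrite !measure0.
  rewrite -[LHS]/(P (cyl N N.+1 a B `&` [set w | I N w = i])).
  rewrite -[RHS]/(n%:R^-1%:E * P (cyl N N.+1 a B)).
  by rewrite cyl_index_prob// cyl_noise_prob// muleCA.
- move=> k; apply: le_lt_trans (ltry 1%R); apply: probability_le1.
  by apply: measurableI => //; exact: measurable_cyl.
Qed.

Lemma sigma_noise_prob N A B' : <<s cylinders N N >> A -> measurable B' ->
  P (A `&` U N @^-1` B') = P A * unif B'.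
Proof.
move=> sA mB'.
have mD : measurable (U N @^-1` B').
  by rewrite -[X in measurable X]setTI; exact: measurable_noise.
have c0 : (0 <= fine (unif B'))%R by exact: fine_ge0.
have cE : (fine (unif B'))%:E = unif B' by rewrite fineK// fin_num_measure.
rewrite muleC -cE.
apply: (@g_sigma_algebra_measure_unique _ _ _ (cylinders N N) _
  (fun k => cyl N N (assignment k) (fun=> setT)) _ _
  (mrestr P mD) (mscale (NngNum c0) P)) => //.
- exact: cylinders_measurable.
- by move=> k; right; exists (assignment k), (fun=> setT).
- exact: cylinders_cover.
- exact: cylinders_setI.
- move=> _ [->|[a [B [mB ->]]]]; first by rewrite !measure0.
  rewrite -[LHS]/(P (cyl N N a B `&` U N @^-1` B')).
  rewrite -[RHS]/((fine (unif B'))%:E * P (cyl N N a B)).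
  rewrite cyl_noise cyl_noise_prob; last by move=> m; rewrite /set_at; case: eqP.
  rewrite cE cyl_prob// {2}/set_at eqxx muleC; congr (_ * _).
  by apply: eq_bigr => m _; rewrite /set_at ltn_eqF.
- move=> k; apply: le_lt_trans (ltry 1%R); apply: probability_le1.
  by apply: measurableI => //; exact: measurable_cyl.
Qed.

Lemma noise_ae_trunc : {ae P, forall w, forall m, trunc (U m w) = U m w}.
Proof.
apply/ae_foralln => m.
have mO : measurable (~` @open_m1_1 R).
  by apply: measurableC; exact: measurable_itv.
exists (U m @^-1` ~` @open_m1_1 R); split.
- by rewrite -[X in measurable X]setTI; exact: measurable_noise.
- transitivity (P (setT `&` U m @^-1` ~` @open_m1_1 R)); first by rewrite setTI.
  rewrite sigma_noise_prob//; last first.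
    exact: (@measurableT _ (g_sigma_algebraType (cylinders m m))).
  by rewrite uniform_probE// setICl measure0 mul0e mule0.
- move=> w /= hw; rewrite /open_m1_1/= in_itv/= => /andP[u1 u2]; apply: hw.
  by rewrite /trunc ler_norml !ltW.
Qed.

Lemma integral_index N i (Z : T -> R) :
  measurable_fun setT (Z : g_sigma_algebraType (cylinders N N.+1) -> R) ->
  (forall w, 0 <= Z w)%R ->
  \int[P]_(w in [set w | I N w = i]) (Z w)%:E = n%:R^-1%:E * \int[P]_w (Z w)%:E.
Proof.
move=> mZ Z0.
have c0 : (0 <= n%:R^-1 :> R)%R by rewrite invr_ge0.
apply: (@integral_proportional _ _ _ P _ (@cylinders_measurable N N.+1) _
  (measurable_index N i) (NngNum c0) (EFin \o Z)).
- by move=> A sA; exact: sigma_index_prob.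
- exact/measurable_EFinP.
- by move=> w; rewrite lee_fin.
Qed.

(** The factor [1 + trunc (U N w)] has mean 1 and is independent of the past, hence drops out. *)
Lemma integral_noise N (Z : T -> R) :
  measurable_fun setT (Z : g_sigma_algebraType (cylinders N N) -> R) ->
  (forall w, 0 <= Z w)%R ->
  \int[P]_w (Z w * (1 + trunc (U N w)))%:E = \int[P]_w (Z w)%:E.
Proof.
move=> mZ Z0.
rewrite (@integral_independent _ _ _ P _ (@cylinders_measurable N N) _
  (measurableTypeR R) (U N) unif Z (fun x => 1 + trunc x)%R)//.
- by rewrite integral_uniform_trunc mule1.
- exact: measurable_noise.
- by move=> A B sA mB; exact: sigma_noise_prob.
- by apply: measurable_funD => //; exact: measurable_trunc.
- by move=> x; have := trunc_le1 x; rewrite ler_norml; lra.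
Qed.

End Noise.

(** * Almost sure convergence of the displacements *)

Section SummableIntegrals.
Local Open Scope ereal_scope.
Variables (R : realType) (dT : measure_display) (T : measurableType dT).
Variables (P : probability T R).

Lemma nneseries_fin_cvg0 (u : nat -> R) : (forall m, 0 <= u m)%R ->
  \sum_(m <oo) (u m)%:E \is a fin_num -> u @ \oo --> 0%R.
Proof.
move=> u0 fin; apply: cvg_series_cvg_0; apply: nondecreasing_is_cvgn.
  by apply: nondecreasing_series => m _ _.
exists (fine (\sum_(m <oo) (u m)%:E)) => _ [N _ <-].
rewrite -lee_fin fineK// /series/= -sumEFin.
by apply: nneseries_lim_ge => m _; rewrite lee_fin.
Qed.

(** By monotone convergence the sum of the series is integrable, so it is finite almost everywhere
    and its terms tend to 0. *)
Lemma ae_cvg0_of_summable (S : nat -> T -> R) (C : R) :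
  (forall m, measurable_fun setT (S m)) -> (forall m w, 0 <= S m w)%R ->
  (forall N, \sum_(m < N) \int[P]_w (S m w)%:E <= C%:E) ->
  {ae P, forall w, S ^~ w @ \oo --> 0%R}.
Proof.
move=> mS S0 SC.
have mS' m : measurable_fun setT (fun w => (S m w)%:E) by exact/measurable_EFinP.
pose F w := \sum_(m <oo) (S m w)%:E.
have F0 w : 0 <= F w by apply: nneseries_ge0 => m _ _; rewrite lee_fin.
have intF : P.-integrable setT F.
  apply/integrableP; split.
    by apply: ge0_emeasurable_sum => // m w _ _; rewrite lee_fin.
  under eq_integral do rewrite gee0_abs//.
  rewrite /F integral_nneseries//; last by move=> m w _; rewrite lee_fin.
  apply: le_lt_trans (ltry C); apply: lime_le.
    by apply: is_cvg_nneseries => m _ _; apply: integral_ge0 => w _; rewrite lee_fin.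
  by near=> N; rewrite big_mkord.
have := integrable_ae measurableT intF; apply: filterS => w /(_ Logic.I).
exact: nneseries_fin_cvg0.
Unshelve. all: by end_near. Qed.

End SummableIntegrals.

(** * Expected energy balance of the process *)

Section Process.
Variables (R : realType) (dT : measure_display) (T : measurableType dT).
Variables (P : probability T R) (n d : nat) (k : R -> R) (hmin hmax h1 : R).
Variables (nu : nat -> R) (X0 : 'I_n -> 'rV[R]_d).
Variables (I : nat -> T -> 'I_n) (U : nat -> T -> R).
Hypothesis n0 : (0 < n)%N.
Hypothesis hk : is_profile k.
Hypotheses (hmin0 : 0 < hmin) (hminmax : hmin < hmax).
Hypotheses (h1min : hmin <= h1) (h1max : h1 <= hmax).
Hypothesis nu0 : forall m, 0 <= nu m.
Hypothesis hN : dsms_noise P I U.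

Let V m w := trunc (U m w).
Let h m w := dsms_band hmin hmax h1 nu (V ^~ w) m.
Let X m w := dsms_state k hmin hmax h1 nu (V ^~ w) (I ^~ w) X0 m.
Let D m i w := sqn (displ k (h m w) (X m w) i).
Let e m w := energy k (h m w) (X m w).
(** The energy halfway through a step: new state, old bandwidth. *)
Let e' m w := energy k (h m w) (X m.+1 w).
(** The coefficient of the noise [V m.+1] in the linearised bandwidth step. *)
Let Z m w := band_drift k (h m w) (X m.+1 w) *
             dsms_delta hmin hmax (nu m.+1) (h m w).

Let hbounds m w : hmin <= h m w <= hmax.
Proof. by apply: dsms_band_bounds => // j; exact: trunc_le1. Qed.

Let delta0 m w : 0 <= dsms_delta hmin hmax (nu m.+1) (h m w).
Proof. exact: dsms_delta_ge0. Qed.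

Let Z0 m w : 0 <= Z m w.
Proof. by rewrite mulr_ge0 ?band_drift_ge0. Qed.

Let D0 m i w : 0 <= D m i w.
Proof. exact: sqn_ge0. Qed.

Let Zbound m w : Z m w <= n%:R ^+ 2 * k 0.
Proof.
have [p1 p2] := (hmin0, hminmax).
have de1 : dsms_delta hmin hmax (nu m.+1) (h m w) <= 1.
  apply: (@le_trans _ _ (1 - (h m w / hmax) ^+ 2)).
    by rewrite /dsms_delta !ge_min lexx !orbT.
  by rewrite gerBl sqr_ge0.
apply: le_trans (band_drift_bound hk (h m w) (X m.+1 w)).
by rewrite -[leRHS]mulr1 ler_wpM2l ?band_drift_ge0.
Qed.

(** [hmax] gives the least value of [h^-1 ^+ 2], hence a gain uniform in time. *)
Let c := hmax^-1 ^+ 2 * slope k 0.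

Let c_gt0 : 0 < c.
Proof.
have [p1 p2] := (hmin0, hminmax).
by rewrite mulr_gt0 ?exprn_gt0 ?invr_gt0 ?slope_gt0//; lra.
Qed.

Let index_step m w : e m w + c * D m (I m w) w <= e' m w.
Proof.
have [p1 p2] := (hmin0, hminmax).
apply: le_trans (energy_update hk (h m w) (X m w) (I m w)).
have /andP[hl hu] := hbounds m w.
rewrite lerD2l ler_wpM2r ?D0// /c ler_wpM2r ?slope_ge0//.
by rewrite ler_pXn2r ?nnegrE ?invr_ge0 ?lef_pV2 ?posrE//; lra.
Qed.

(** [Z m w] is added on both sides so that only nonnegative functions are integrated later. *)
Let band_step m w : e' m w + Z m w <= e m.+1 w + Z m w * (1 + V m.+1 w).
Proof.
have hE := dsms_band_step hmin0 hminmax h1min h1max nu0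
  (fun j => trunc_le1 (U j w)) m.
have := energy_band hk (X m.+1 w) hE.
rewrite -/(h m.+1 w) -/(h m w) -/(e m.+1 w) -/(e' m w) -/(V m.+1 w) /Z.
by move: (band_drift _ _ _) (dsms_delta _ _ _ _) (e m.+1 w) => b de E; lra.
Qed.

Let mV_sub p q m : (m < q)%N ->
  measurable_fun setT (V m : g_sigma_algebraType (cylinders I U p q) -> R).
Proof.
move=> mq; apply: (measurableT_comp (@measurable_trunc R)) => _ B mB.
by rewrite setTI; exact: sigma_cyl_noise.
Qed.

Let mI_sub p q m a : (m < p)%N ->
  measurable ([set w | I m w = a] : set (g_sigma_algebraType (cylinders I U p q))).
Proof. by move=> mp; exact: sigma_cyl_index. Qed.

Let mX_sub m q i l : (m <= q)%N -> measurable_fun setT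
  ((fun w => X m w i ord0 l) : g_sigma_algebraType (cylinders I U m q) -> R).
Proof.
move=> mq; apply: (@measurable_dsms_state _
  (g_sigma_algebraType (cylinders I U m q))) => // j.
  by move=> a jm; exact: mI_sub.
by move=> jm; apply: mV_sub; exact: leq_trans mq.
Qed.

Let mh_sub p q m : (m < q)%N ->
  measurable_fun setT (h m : g_sigma_algebraType (cylinders I U p q) -> R).
Proof.
move=> mq; apply: (@measurable_dsms_band _
  (g_sigma_algebraType (cylinders I U p q))) => j jm.
by apply: mV_sub; exact: leq_ltn_trans mq.
Qed.

(** The displacements at time [m] depend on [X m] and [h m], which are fixed before [I m] is
    drawn. *)
Let mD_sub m i : measurable_fun setT
  (D m i : g_sigma_algebraType (cylinders I U m m.+1) -> R).
Proof.
apply: (@measurable_sqn_displ _ (g_sigma_algebraType (cylinders I U m m.+1))) => //.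
  exact: mh_sub.
by move=> a l; exact: mX_sub.
Qed.

(** The drift coefficient is fixed before [U m.+1] is drawn. *)
Let mZ_sub m : measurable_fun setT
  (Z m : g_sigma_algebraType (cylinders I U m.+1 m.+1) -> R).
Proof.
have mh := @mh_sub m.+1 m.+1 m (leqnn _).
apply: measurable_funM; last exact: measurable_dsms_delta.
apply: (@measurable_band_drift _
  (g_sigma_algebraType (cylinders I U m.+1 m.+1))) => // i l.
exact: mX_sub.
Qed.

Let refine p q (f : T -> R) :
  measurable_fun setT (f : g_sigma_algebraType (cylinders I U p q) -> R) ->
  measurable_fun setT f.
Proof. by apply: measurable_refine; exact: (cylinders_measurable hN). Qed.

Let mX m i l : measurable_fun setT (fun w => X m w i ord0 l).
Proof. exact: refine (@mX_sub m m i l (leqnn _)). Qed.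

Let mh m : measurable_fun setT (h m).
Proof. exact: refine (@mh_sub m m.+1 m (leqnn _)). Qed.

Let me m : measurable_fun setT (e m).
Proof. exact: measurable_energy. Qed.

Let me' m : measurable_fun setT (e' m).
Proof. exact: measurable_energy. Qed.

Let mV m : measurable_fun setT (V m).
Proof.
apply: (measurableT_comp (@measurable_trunc R)); exact: (measurable_noise hN).
Qed.

Local Open Scope ereal_scope.

Let integral_bound (f : T -> R) (M : R) : measurable_fun setT f ->
  (forall w, 0 <= f w <= M)%R -> \int[P]_w (f w)%:E <= M%:E.
Proof.
move=> mf fM.
apply: (@le_trans _ _ (\int[P]_w (cst M%:E w))).
  apply: ge0_le_integral => //.
  - by move=> w _; rewrite lee_fin; case/andP: (fM w).
  - exact/measurable_EFinP.
  - by move=> w _; rewrite lee_fin; case/andP: (fM w).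
by rewrite integral_cst//= probability_setT mule1.
Qed.

Let integralD_EFin (f g : T -> R) : measurable_fun setT f -> measurable_fun setT g ->
  (forall w, 0 <= f w)%R -> (forall w, 0 <= g w)%R ->
  \int[P]_w (f w + g w)%:E = \int[P]_w (f w)%:E + \int[P]_w (g w)%:E.
Proof.
move=> mf mg f0 g0; under eq_integral do rewrite EFinD.
rewrite ge0_integralD//; try exact/measurable_EFinP;
  by move=> w _; rewrite lee_fin.
Qed.

Let le_integral_EFin (f g : T -> R) :
  measurable_fun setT f -> measurable_fun setT g ->
  (forall w, 0 <= f w)%R -> (forall w, f w <= g w)%R ->
  \int[P]_w (f w)%:E <= \int[P]_w (g w)%:E.
Proof.
move=> mf mg f0 fg; apply: ge0_le_integral => //; try exact/measurable_EFinP;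
  by move=> w _; rewrite lee_fin.
Qed.

Let band_integral m : \int[P]_w (e' m w)%:E <= \int[P]_w (e m.+1 w)%:E.
Proof.
have mZ := refine (@mZ_sub m).
have V0 w : (0 <= 1 + V m.+1 w)%R.
  by have := trunc_le1 (U m.+1 w); rewrite ler_norml -/(V m.+1 w); lra.
have mZV : measurable_fun setT (fun w => Z m w * (1 + V m.+1 w))%R.
  by apply: measurable_funM => //; apply: measurable_funD.
have fin : \int[P]_w (Z m w)%:E \is a fin_num.
  rewrite ge0_fin_numE; last by apply: integral_ge0 => w _; rewrite lee_fin.
  apply: le_lt_trans (ltry (n%:R ^+ 2 * k 0)%R); apply: integral_bound => // w.
  by rewrite Z0 Zbound.
(* The integral of [Z m] is finite, so it can be added to both sides; on the right it is rewritten
   as the integral of [Z m] times the mean-one factor. *)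
rewrite -(leeD2rE _ _ fin) -{2}(integral_noise n0 hN (@mZ_sub m) (Z0 m)).
rewrite -!integralD_EFin//.
- apply: le_integral_EFin => //.
  + exact: measurable_funD.
  + exact: measurable_funD.
  + by move=> w; rewrite addr_ge0 ?energy_ge0.
- by move=> w; exact: energy_ge0.
- by move=> w; rewrite mulr_ge0//; exact: V0.
- by move=> w; exact: energy_ge0.
Qed.

Let mDI m : measurable_fun setT (fun w => D m (I m w) w).
Proof.
rewrite (_ : (fun w => _) = (fun w => \sum_i if I m w == i then D m i w else 0)%R).
  apply: measurable_sum => i; apply: measurable_fun_ifT => //.
    apply: (measurable_fun_bool true); rewrite setTI.
    rewrite (_ : _ @^-1` _ = [set w | I m w = i]); first exact: (measurable_index hN).
    by apply/seteqP; split=> w /= /eqP.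
  exact: refine (@mD_sub m i).
apply/funext => w; rewrite (bigD1 (I m w))//= eqxx big1 ?addr0// => i.
by rewrite eq_sym => /negbTE ->.
Qed.

(** Split according to the value of [I m]; each event has conditional probability [n%:R^-1] given
    the past. *)
Let integral_DI m : \int[P]_w (D m (I m w) w)%:E =
  n%:R^-1%:E * \int[P]_w (\sum_i D m i w)%:E.
Proof.
have mD i : measurable_fun setT (D m i) by exact: refine (@mD_sub m i).
have mE i : measurable [set w | I m w = i] by exact: (measurable_index hN).
transitivity (\sum_i \int[P]_(w in [set w | I m w = i]) (D m i w)%:E).
  under [RHS]eq_bigr do rewrite integral_mkcond.
  rewrite -ge0_integral_sum//.
  - apply: eq_integral => w _; rewrite (bigD1 (I m w))//= big1 ?adde0.
      by rewrite patchE mem_set.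
    move=> i iI; rewrite patchE memNset//= => Ii.
    by move: iI; rewrite Ii eqxx.
  - move=> i; apply/(measurable_restrictT _ (mE i)); apply: measurable_funTS.
    exact/measurable_EFinP.
  - by move=> i w _; rewrite patchE; case: ifP => // _; rewrite lee_fin.
rewrite (eq_bigr (fun i => n%:R^-1%:E * \int[P]_w (D m i w)%:E)); last first.
  by move=> i _; exact: (integral_index n0 hN i (@mD_sub m i) (D0 m i)).
rewrite -ge0_sume_distrr; last first.
  by move=> i _; apply: integral_ge0 => w _; rewrite lee_fin.
congr (_ * _); under [RHS]eq_integral do rewrite -sumEFin.
rewrite ge0_integral_sum//.
- by move=> i; exact/measurable_EFinP.
- by move=> i w _; rewrite lee_fin.
Qed.

Let index_integral m : \int[P]_w (e m w)%:E +
  (c / n%:R)%:E * \int[P]_w (\sum_i D m i w)%:E <= \int[P]_w (e' m w)%:E.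
Proof.
rewrite EFinM -muleA -integral_DI -ge0_integralZl//; last 3 first.
- exact/measurable_EFinP.
- by move=> w _; rewrite lee_fin.
- by rewrite lee_fin ltW.
under [X in _ + X]eq_integral do rewrite -EFinM.
have mcD : measurable_fun setT (fun w => c * D m (I m w) w)%R.
  by apply: measurable_funM.
have cD0 w : (0 <= c * D m (I m w) w)%R by rewrite mulr_ge0// ltW.
rewrite -integralD_EFin//; last by move=> w; exact: energy_ge0.
apply: le_integral_EFin => //; first exact: measurable_funD.
by move=> w; rewrite addr_ge0 ?energy_ge0.
Qed.

(** Index and bandwidth steps alternate and the energies telescope. *)
Let sum_bound N : \int[P]_w (e 0%N w)%:E +
  \sum_(m < N) (c / n%:R)%:E * \int[P]_w (\sum_i D m i w)%:E <=
  \int[P]_w (e N w)%:E.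
Proof.
elim: N => [|N IH]; first by rewrite big_ord0 adde0.
rewrite big_ord_recr/= addeA.
apply: le_trans (band_integral N); apply: le_trans (index_integral N).
exact: leeD2r.
Qed.

Lemma ae_displ_cvg0 : {ae P, forall w, forall i, D ^~ i ^~ w @ \oo --> 0%R}.
Proof.
have cn0 : (0 < c / n%:R)%R by rewrite divr_gt0 ?ltr0n.
have Dsum0 m w : (0 <= \sum_i D m i w)%R by apply: sumr_ge0.
have ae0 : {ae P, forall w, (fun m => \sum_i D m i w)%R @ \oo --> 0%R}.
  (* The bound is the maximal energy divided by the expected gain factor [c / n%:R]. *)
  apply: (@ae_cvg0_of_summable _ _ _ P (fun m w => \sum_i D m i w)%R
    ((c / n%:R)^-1 * (n%:R ^+ 2 * k 0))) => // [m|N].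
    by apply: measurable_sum => i; exact: refine (@mD_sub m i).
  rewrite EFinM lee_pdivlMl// ge0_sume_distrr; last first.
    by move=> m _; apply: integral_ge0 => w _; rewrite lee_fin.
  apply: (@le_trans _ _ (\int[P]_w (e N w)%:E)).
    apply: le_trans (sum_bound N); rewrite leeDr//.
    by apply: integral_ge0 => w _; rewrite lee_fin energy_ge0.
  by apply: integral_bound => // w; rewrite energy_ge0// energy_bound.
apply: filterS ae0 => w cv i.
apply: (@squeeze_cvgr _ _ _ _ (fun=> 0%R) (fun m => \sum_i D m i w)%R) => //.
- near=> m; rewrite D0/= (bigD1 i)//= lerDl.
  by apply: sumr_ge0.
- exact: cvg_cst.
Unshelve. all: by end_near. Qed.

(** Outside two null sets the noise equals its truncation and all displacements tend to 0; the
    deterministic result then applies to each outcome. *)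
Lemma ae_clusters (tau : R) : (0 < tau)%R -> (tau < hmin / 2)%R ->
  {ae P, forall w,
    let X := dsms_state k hmin hmax h1 nu (fun m => U m w) (fun m => I m w) X0 in
    exists (M : nat) (c : 'I_n -> 'I_M),
      (forall l : 'I_M, exists i, c i = l) /\
      (exists K : nat, forall m, (K <= m)%N ->
         (forall i j, c i = c j -> eucdist (X m i) (X m j) < tau)%R /\
         (forall i j, c i <> c j -> hmin - tau < eucdist (X m i) (X m j))%R) /\
      (forall i j, c i = c j ->
         (fun m => eucdist (X m i) (X m j)) @ \oo --> 0%R)}.
Proof.
move=> tau0 tauh.
apply: filterS2 (noise_ae_trunc n0 hN) ae_displ_cvg0 => w tU Dcvg /=.
have -> : (fun m => U m w) = V ^~ w by apply/funext => m; rewrite /V tU.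
apply: (@displ_clusters _ k _ _ hmin hmax tau _ (X ^~ w) (h ^~ w) (I ^~ w)) => //.
by move=> m i l; exact: dsms_state_bound.
Qed.

End Process.

Theorem theorem2 (R : realType) (dT : measure_display) (T : measurableType dT)
    (P : probability T R) (n d : nat) (k : R -> R) (hmin hmax h1 tau : R)
    (nu : nat -> R) (X0 : 'I_n -> 'rV[R]_d)
    (I : nat -> T -> 'I_n) (U : nat -> T -> R) :
  (0 < n)%N -> (0 < d)%N ->
  is_profile k ->
  0 < hmin -> hmin < hmax ->
  hmin <= h1 -> h1 <= hmax ->
  (forall m, 0 <= nu m) -> nu @ \oo --> 0 ->
  0 < tau -> tau < hmin / 2 ->
  dsms_noise P I U ->
  {ae P, forall w,
    let X := dsms_state k hmin hmax h1 nu (fun m => U m w) (fun m => I m w) X0 in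
    exists (M : nat) (c : 'I_n -> 'I_M),
      (forall l : 'I_M, exists i, c i = l) /\
      (exists K : nat, forall m, (K <= m)%N ->
         (forall i j, c i = c j -> eucdist (X m i) (X m j) < tau) /\
         (forall i j, c i <> c j -> hmin - tau < eucdist (X m i) (X m j))) /\
      (forall i j, c i = c j ->
         (fun m => eucdist (X m i) (X m j)) @ \oo --> 0)}.
Proof.
move=> n0 _ hk hmin0 hminmax h1min h1max nu0 _ tau0 tauh hN.
exact: ae_clusters.
Qed.
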